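(* Let $a,b>0$ and let $g\in W(L^\infty,\ell^1)$ be such that $(g,a,b)$ is a WH-frame with frame bounds $A,B$, and let $0<R<bA$. Then there exist $\epsilon$ with $0<\epsilon\le \frac a2$ and $b_0=b_0(\epsilon)>0$ such that whenever $a'$ satisfies $|a-a'|<\epsilon$ and $$\sum_{n\in\mathbb Z}|g(t-na)-g(t-na')|^2\le R\quad\text{for a.e. } t\in\mathbb R,$$ then $(g,a',b')$ is a WH-frame for every $b'$ with $0<b'<b_0$.
   Context: A sequence $(f_n)_{n\in I}$ in a Hilbert space $H$ is a frame for $H$ with frame bounds $A,B$ (lower bound $A$, upper bound $B$) if $A,B>0$ and $A\|f\|^2\le\sum_{n\in I}|\langle f,f_n\rangle|^2\le B\|f\|^2$ for all $f\in H$ (the bounds need not be optimal). For $g\in L^2(\mathbb R)$ (complex-valued), $a,b>0$ and $m,n\in\mathbb Z$, put $E_{mb}g(t)=e^{2\pi i mbt}g(t)$ and $T_{na}g(t)=g(t-na)$. The triple $(g,a,b)$ is called a Weyl-Heisenberg frame (WH-frame) for $L^2(\mathbb R)$ if $(E_{mb}T_{na}g)_{m,n\in\mathbb Z}$ is a frame for $L^2(\mathbb R)$; its frame bounds are those of this sequence. The Wiener amalgam space $W(L^\infty,\ell^1)$ is the set of $g\in L^2(\mathbb R)$ such that for some $a>0$, $\|g\|_{W,a}:=\sum_{n\in\mathbb Z}\|T_{na}g\cdot\chi_{[0,a)}\|_\infty<\infty$, where $\|\cdot\|_\infty$ is the essential supremum norm (finiteness for one $a>0$ implies finiteness for all $a>0$).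 *)

(* Defs.v *)
From HB Require Import structures.
From mathcomp Require Import all_boot all_order all_algebra.
From mathcomp Require Import complex.
From mathcomp Require Import all_classical all_reals all_analysis.

Set Implicit Arguments.
Unset Strict Implicit.
Unset Printing Implicit Defensive.

Import Order.TTheory GRing.Theory Num.Theory.

Local Open Scope classical_set_scope.
Local Open Scope ring_scope.
Local Open Scope complex_scope.

Section WeylHeisenberg.
Variable R : realType.
Local Notation mu := (@lebesgue_measure R).

Definition Cnorm (z : R[i]) : R := ComplexField.Normc.normc z.

(* R[i] has no measurable structure in the library; the sigma-algebra on R
   is the Borel one, which is harmless since every class in L^2(R) has a
   Borel representative. *)
Definition Cmeasurable (f : R -> R[i]) : Prop :=
  measurable_fun [set: R] (fun t => complex.Re (f t)) /\
  measurable_fun [set: R] (fun t => complex.Im (f t)).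

Definition CLnorm (p : \bar R) (f : R -> R[i]) : \bar R :=
  ('N[mu]_p[EFin \o (Cnorm \o f)])%E.

(* Elements of L^2(R) are represented by functions; all the notions below
   are invariant under almost everywhere equality. *)
Definition L2 (f : R -> R[i]) : Prop :=
  Cmeasurable f /\ (CLnorm 2%:E f < +oo)%E.

Definition Cintegral (f : R -> R[i]) : R[i] :=
  (\int[mu]_t complex.Re (f t)) +i* (\int[mu]_t complex.Im (f t)).

Definition inner (f h : R -> R[i]) : R[i] :=
  Cintegral (fun t => f t * (h t)^*).

Definition frame_with_bounds (I : choiceType) (F : I -> R -> R[i]) (A B : R)
    : Prop :=
  [/\ 0 < A, 0 < B, forall i, L2 (F i) &
    forall f, L2 f ->
      let S := (\esum_(i in [set: I]) ((Cnorm (inner f (F i))) ^+ 2)%:E)%E in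
      (A%:E * CLnorm 2%:E f ^+ 2 <= S)%E /\
      (S <= B%:E * CLnorm 2%:E f ^+ 2)%E].

Definition expi (x : R) : R[i] := cos x +i* sin x.

Definition modulation (c : R) (g : R -> R[i]) : R -> R[i] :=
  fun t => expi (2 * pi * c * t) * g t.

Definition translation (c : R) (g : R -> R[i]) : R -> R[i] :=
  fun t => g (t - c).

Definition WHsystem (g : R -> R[i]) (a b : R) (mn : int * int) : R -> R[i] :=
  modulation (mn.1%:~R * b) (translation (mn.2%:~R * a) g).

Definition WHframe_with_bounds (g : R -> R[i]) (a b A B : R) : Prop :=
  [/\ L2 g, 0 < a, 0 < b & frame_with_bounds (WHsystem g a b) A B].

Definition WHframe (g : R -> R[i]) (a b : R) : Prop :=
  exists A B, WHframe_with_bounds g a b A B.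

Definition cut (a : R) (f : R -> R[i]) : R -> R[i] :=
  fun t => f t * (\1_(`[0%R, a[%classic) t)%:C.

Definition Wnorm (a : R) (g : R -> R[i]) : \bar R :=
  (\esum_(n in [set: int]) CLnorm +oo (cut a (translation (n%:~R * a)%R g)))%E.

Definition Wiener (g : R -> R[i]) : Prop :=
  L2 g /\ exists2 a : R, 0 < a & (Wnorm a g < +oo)%E.

End WeylHeisenberg.

(* Main.v *)
Require Import Defs.
From HB Require Import structures.
From mathcomp Require Import all_boot all_order all_algebra.
From mathcomp Require Import complex ring lra zify finmap.
From mathcomp Require Import all_classical all_reals all_analysis.
From mathcomp Require Import measurable_realfun ess_sup_inf.
Set Implicit Arguments.
Unset Strict Implicit.
Unset Printing Implicit Defensive.
Import Order.TTheory GRing.Theory Num.Theory.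
Import numFieldNormedType.Exports.
Local Open Scope classical_set_scope.
Local Open Scope ring_scope.

(** Write S(f) for the sum over m and n of |<f, E_mb T_na g>|^2 and G_a(t) for
    the sum over n of |g(t - na)|^2; these are [gabor] and [density] below.  If,
    for each n, the product of f with the conjugate of T_na g lives in an
    interval of length 1/b, then the sum over m is an instance of Parseval's
    identity for the exponentials of period 1/b, and S(f) equals
    b^-1 * \int |f|^2 G_a exactly ([gabor_window]).  This identity is used in
    both directions.

    From the frame to G_a: for f the indicator of a set on which G_a <= c < bA,
    cut to an interval of length 1/b, the lower frame bound contradicts the
    identity unless that set is null.  Hence G_a >= bA almost everywhere
    ([frame_density_ge]).  Now |x|^2 <= (1 + d)|y|^2 + (1 + 1/d)|x - y|^2, and
    r < bA leaves room for a d with (1 + 1/d) r < bA, so the hypothesis on a'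
    yields a constant c > 0 with G_a' >= c ([density_perturbation]).

    From G_a' back to a frame: cut g into its pieces on the cells of length w0
    supplied by the amalgam norm.  At most K translates of a cell by multiples
    of a' meet a given point, with K independent of a' > a/2 (the role of the
    bound a/2 on epsilon); so the identity bounds the Gabor sum of one piece by
    (K/b') ||f||^2 times the square of its sup norm, and Minkowski's inequality
    in l^2 adds the pieces ([gabor_bigcup_le]).  All pieces together give the
    upper frame bound.  For the lower one let g1 gather finitely many pieces,
    so that the remainder g2 has amalgam norm at most tau.  As g1 has bounded
    support, the identity applies to it as soon as 1/b' exceeds the length of
    that support, whatever a' is; this determines b0.  Since G_a' of g1 is at
    least c - K tau^2 and S_g1 <= 2 S_g + 2 S_g2, a small tau gives
    S_g(f) >= c/(4b') ||f||^2.

    Parseval's identity is proved for real functions; the complex case follows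
    by pairing the frequencies m and -m ([complex_parseval]).  Bessel's
    inequality makes the defect T ||u||^2 - (sum of squared coefficients) a
    nonnegative quadratic form, so the functions where it vanishes form a
    closed subspace of L^2.  It contains the trigonometric polynomials, hence,
    through polynomials in a cosine that converge to the indicator of an arc,
    the indicators of intervals; a pi-lambda argument reaches all Borel sets
    and simple functions reach all of L^2 ([parseval_sqint]). *)

(** * Square integrable real functions *)
Section SquareIntegrable.
Context d (T : measurableType d) (R : realType).
Variables (mu : {measure set T -> \bar R}) (D : set T).
Hypothesis mD : measurable D.
Implicit Types u v w : T -> R.

Definition sqint u : Prop :=
  measurable_fun [set: T] u /\ mu.-integrable D (EFin \o (fun t => u t ^+ 2)).

Definition ip u v : R := \int[mu]_(t in D) (u t * v t).

Lemma sqint_mul u v : sqint u -> sqint v ->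
  mu.-integrable D (EFin \o (fun t => u t * v t)).
Proof.
move=> [mu_ iu] [mv iv].
apply: (le_integrable mD _ _ (integrableD mD iu iv)).
  by apply/measurable_EFinP/measurable_funTS; apply: measurable_funM.
move=> t _ /=; rewrite lee_fin normrM [leRHS]ger0_norm ?addr_ge0 ?sqr_ge0//.
rewrite -[u t ^+ 2]real_normK ?num_real// -[v t ^+ 2]real_normK ?num_real//.
have := sqr_ge0 (`|u t| - `|v t|); have := mulr_ge0 (normr_ge0 (u t)) (normr_ge0 (v t)).
nra.
Qed.

Lemma sqintZ c u : sqint u -> sqint (fun t => c * u t).
Proof.
move=> [mu_ iu]; split; first by apply: measurable_funM.
have := integrableZl mD (c ^+ 2) iu; apply: eq_integrable => // t _ /=.
by rewrite -EFinM exprMn.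
Qed.

Lemma sqintD u v : sqint u -> sqint v -> sqint (fun t => u t + v t).
Proof.
move=> su sv; have [mu_ iu] := su; have [mv iv] := sv.
split; first exact: measurable_funD.
have := integrableD mD (integrableD mD iu iv) (integrableZl mD 2 (sqint_mul su sv)).
by apply: eq_integrable => // t _ /=; rewrite -!EFinM -!EFinD; congr EFin; ring.
Qed.

Lemma sqintB u v : sqint u -> sqint v -> sqint (fun t => u t - v t).
Proof.
move=> su sv; have := sqintD su (sqintZ (-1) sv).
by congr sqint; apply/funext => t; rewrite mulN1r.
Qed.

Lemma ipC u v : ip u v = ip v u.
Proof. by apply: eq_Rintegral => t _; rewrite mulrC. Qed.

Lemma ipDl u v w : sqint u -> sqint v -> sqint w ->
  ip (fun t => u t + v t) w = ip u w + ip v w.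
Proof.
move=> su sv sw; rewrite /ip -RintegralD//; [|exact: sqint_mul..].
by apply: eq_Rintegral => t _; rewrite mulrDl.
Qed.

Lemma ipZl c u w : sqint u -> sqint w -> ip (fun t => c * u t) w = c * ip u w.
Proof.
move=> su sw; rewrite /ip -RintegralZl//; last exact: sqint_mul.
by apply: eq_Rintegral => t _; rewrite mulrA.
Qed.

Lemma ipBl u v w : sqint u -> sqint v -> sqint w ->
  ip (fun t => u t - v t) w = ip u w - ip v w.
Proof.
move=> su sv sw; rewrite /ip -RintegralB//; [|exact: sqint_mul..].
by apply: eq_Rintegral => t _; rewrite mulrBl.
Qed.

Lemma ip_ge0 u : 0 <= ip u u.
Proof. by apply: Rintegral_ge0 => t _; rewrite -expr2 sqr_ge0. Qed.

Lemma sqint_bounded u c : (mu D < +oo)%E -> measurable_fun [set: T] u ->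
  (forall t, `|u t| <= c) -> sqint u.
Proof.
move=> Dfin mu_ uc; split=> //.
apply: measurable_bounded_integrable => //.
  by apply/measurable_funTS; exact: measurable_funX.
exists (c ^+ 2); split; first exact: num_real.
move=> x cx t _ /=; rewrite normrX (le_trans _ (ltW cx))//.
by rewrite lerXn2r ?nnegrE// (le_trans _ (uc t)).
Qed.

Lemma sqint_sum (I : Type) (r : seq I) (F : I -> T -> R) :
  (forall i, sqint (F i)) -> sqint (fun t => \sum_(i <- r) F i t).
Proof.
move=> sF; elim: r => [|i r IH].
  have -> : (fun t => \sum_(i <- [::]) F i t) = (fun t : T => 0 : R).
    by apply/funext => t; rewrite big_nil.
  split=> //; rewrite (_ : _ \o _ = cst 0%E); first exact: integrable0.
  by apply/funext => t /=; rewrite expr0n.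
have -> : (fun t => \sum_(j <- i :: r) F j t) = (fun t => F i t + \sum_(j <- r) F j t).
  by apply/funext => t; rewrite big_cons.
exact: sqintD.
Qed.

Lemma ip_suml (I : Type) (r : seq I) (F : I -> T -> R) w :
  (forall i, sqint (F i)) -> sqint w ->
  ip (fun t => \sum_(i <- r) F i t) w = \sum_(i <- r) ip (F i) w.
Proof.
move=> sF sw; elim: r => [|i r IH].
  rewrite big_nil -[RHS](mul0r (ip w w)) -ipZl//; congr ip.
  by apply/funext => t; rewrite big_nil mul0r.
rewrite big_cons -IH -ipDl//; last exact: sqint_sum.
by congr ip; apply/funext => t; rewrite big_cons.
Qed.

End SquareIntegrable.

(** * Cosine waves over one period *)
Section Trig.
Variable R : realType.
Local Notation mu := (@lebesgue_measure R).
Variables (b s : R).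
Hypothesis b0 : 0 < b.
Local Notation T := (b^-1).

(** The waves below have the common period T.  The interval is open so that an
    arc of the circle that starts at s is exactly the trace of a ray. *)
Definition window : set R := `]s, s + T[%classic.
Local Notation W := window.

(** The phase makes one function stand for the cosine (th = 0) and the sine
    (th = pi / 2) of frequency m b, and keeps products within the family. *)
Definition wave (m : int) (th t : R) : R := cos (2 * pi * (m%:~R * b) * t - th).

Lemma measurable_window : measurable W. Proof. exact: measurable_itv. Qed.
Hint Resolve measurable_window : core.

Lemma window_measure : mu W = T%:E.
Proof.
rewrite /window lebesgue_measure_itv/= lte_fin ltrDl invr_gt0 b0 -EFinB.
by congr EFin; ring.
Qed.

Lemma window_finite : (mu W < +oo)%E.
Proof. by rewrite window_measure ltry. Qed.

Lemma measurable_wave m th : measurable_fun [set: R] (wave m th).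
Proof.
apply: measurableT_comp; first exact: (continuous_measurable_fun (@continuous_cos R)).
by apply: measurable_funB => //; apply: measurable_funM.
Qed.

Lemma wave_le1 m th t : `|wave m th t| <= 1. Proof. exact: cos_max. Qed.

Lemma sqint_wave m th : sqint mu W (wave m th).
Proof.
by apply: (@sqint_bounded _ _ _ _ _ _ _ 1) => //;
  [exact: window_finite|exact: measurable_wave|exact: wave_le1].
Qed.

Lemma cosDint (m : int) (x : R) : cos (x + 2 * pi * m%:~R) = cos x.
Proof.
have cn (n : nat) (y : R) : cos (y + 2 * pi * n%:R) = cos y.
  by rewrite -[RHS](periodicn (@cosD2pi R) n y) -[pi *+ 2 *+ n]mulr_natr -[pi *+ 2]mulr_natl.
case: m => n; first by rewrite -pmulrn cn.
by rewrite NegzE mulrNz -pmulrn mulrN -[LHS](cn n.+1) subrK.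
Qed.

Lemma wave_shift m th : wave m th (s + T) = wave m th s.
Proof.
rewrite /wave -(cosDint m (_ * s - th)); congr cos.
by field; rewrite gt_eqF.
Qed.

Lemma integral_wave m th :
  \int[mu]_(t in W) wave m th t = if m == 0 then T * cos th else 0.
Proof.
have T0 : 0 < T by rewrite invr_gt0.
have sT : s < s + T by rewrite ltrDl.
case: eqP => [->|/eqP m0].
  rewrite (@eq_Rintegral _ _ _ mu _ (cst (cos th))); last first.
    by move=> t _; rewrite /wave mul0r mulr0 mul0r sub0r cosN.
  by rewrite Rintegral_cst// mulrC; congr (_ * _); exact: (congr1 fine window_measure).
set c := 2 * pi * (m%:~R * b).
have c0 : c != 0.
  by rewrite !mulf_neq0// ?intr_eq0// gt_eqF// ?pi_gt0.
pose F t := sin (c * t - th) / c.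
have dF (t : R) : is_derive t 1 F (wave m th t).
  rewrite /F /wave -/c.
  have h1 : is_derive t 1 (fun x => c * x - th) c.
    rewrite -[X in is_derive _ _ _ X]subr0 -[X in is_derive _ _ _ (X - 0)](mulr1 c).
    apply: is_deriveB.
  have h2 := @is_derive1_comp _ sin (fun x => c * x - th) t _ _ (is_derive_sin _) h1.
  have := is_deriveZ c^-1 h2.
  rewrite [X in is_derive _ _ _ X -> _](_ : _ = cos (c * t - th)); last first.
    by rewrite /GRing.scale/= mulrCA mulVf ?mulr1.
  by congr is_derive; apply/funext => x; rewrite /= /GRing.scale/= mulrC.
have cF : continuous F.
  by move=> t; apply: differentiable_continuous; apply/derivable1_diffP; case: (dF t).
have cw : continuous (wave m th).
  move=> t; apply: continuous_comp; last exact: continuous_cos.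
  by apply: cvgB; [apply: cvgM; [exact: cvg_cst|exact: cvg_id]|exact: cvg_cst].
have FTC := @continuous_FTC2 _ (wave m th) F s (s + T) sT.
rewrite /window /Rintegral -(integral_itv_bndoo true false); last first.
  by apply/measurable_EFinP/measurable_funTS; exact: measurable_wave.
rewrite FTC.
- rewrite /F -EFinB/=.
  have -> : sin (c * (s + T) - th) = sin (c * s - th); last by rewrite subrr.
  have := wave_shift m (th + pi / 2); rewrite /wave -/c !opprD !addrA !cosBpihalf.
  by [].
- exact: continuous_subspaceT.
- split; first by move=> t _; case: (dF t).
    by apply: cvg_at_right_filter; exact: cF.
  by apply: cvg_at_left_filter; exact: cF.
- by move=> t _; rewrite derive1E; case: (dF t).
Qed.

Lemma wave_mul m th k ph t : wave m th t * wave k ph t =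
  2^-1 * (wave (m + k) (th + ph) t + wave (m - k) (th - ph) t).
Proof.
have E (x y : R) : cos x * cos y = 2^-1 * (cos (x + y) + cos (x - y)).
  by rewrite cosB cosD; field.
rewrite /wave E; congr (_ * (cos _ + cos _)).
  by rewrite intrD; ring.
by rewrite intrD rmorphN; ring.
Qed.

Lemma integrable_wave m th : mu.-integrable W (EFin \o wave m th).
Proof.
apply: measurable_bounded_integrable => //; first exact: window_finite.
  apply/measurable_funTS; exact: measurable_wave.
exists 1; split; first exact: num_real.
by move=> x x1 t _ /=; rewrite (le_trans (wave_le1 _ _ _))// ltW.
Qed.

Lemma ip_wave m th k ph : ip mu W (wave m th) (wave k ph) =
  T / 2 * ((m == - k)%:R * cos (th + ph) + (m == k)%:R * cos (th - ph)).
Proof.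
rewrite /ip (@eq_Rintegral _ _ _ mu _ (fun t => 2^-1 *
    (wave (m + k) (th + ph) t + wave (m - k) (th - ph) t))); last first.
  by move=> t _; rewrite wave_mul.
rewrite RintegralZl//; last first.
  by apply: (integrableD _ (integrable_wave (m + k) (th + ph))
    (integrable_wave (m - k) (th - ph))).
rewrite RintegralD//; [|exact: integrable_wave..].
rewrite !integral_wave addr_eq0 subr_eq0.
by case: eqP => _; case: eqP => _; rewrite /=; field; rewrite gt_eqF.
Qed.

End Trig.

(** * Unordered sums *)
Section EsumTools.
Context {R : realType}.
Local Open Scope ereal_scope.

Definition int_of_nat (k : nat) : int := if odd k then Negz k./2 else Posz k./2.

Lemma int_of_nat_bij : set_bij [set: nat] [set: int] int_of_nat.
Proof.
split=> //; rewrite /int_of_nat.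
- move=> i j _ _; case: ifP => oi; case: ifP => oj // [] ij;
  by rewrite -(odd_double_half i) -(odd_double_half j) ij oi oj.
- move=> [n|n] _ /=; [exists n.*2|exists n.*2.+1] => //=.
    by rewrite odd_double doubleK.
  by rewrite odd_double/= uphalf_double.
Qed.

Lemma esum_int (f : int -> \bar R) : (forall n, 0 <= f n) ->
  \esum_(n in [set: int]) f n = \sum_(k <oo) f (int_of_nat k).
Proof.
move=> f0; rewrite (reindex_esum _ _ _ _ int_of_nat_bij).
by rewrite nneseries_esumT.
Qed.

Lemma nneseries_term_le (w : nat -> R) (W : R) (j : nat) :
  (forall i, 0 <= w i)%R -> \sum_(i <oo) (w i)%:E <= W%:E -> (w j <= W)%R.
Proof.
move=> w0 wW; rewrite -lee_fin (le_trans _ wW)//.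
rewrite (@nneseriesD1 _ _ j)//; last by move=> i _; rewrite lee_fin.
by rewrite leeDl// nneseries_ge0// => i _ _; rewrite lee_fin.
Qed.

Lemma esum_seq_le (I : choiceType) (a : I -> \bar R) (M : \bar R) :
  (forall r : seq I, uniq r -> \sum_(i <- r) a i <= M) ->
  \esum_(i in [set: I]) a i <= M.
Proof.
move=> aM; apply: ge_ereal_sup => _ [X [finX _] <-].
by rewrite fsbig_finite//; apply: aM; exact: fset_uniq.
Qed.

Lemma esum_seq_ge (I : choiceType) (a : I -> \bar R) (r : seq I) : uniq r ->
  \sum_(i <- r) a i <= \esum_(i in [set: I]) a i.
Proof.
move=> ur; apply: esum_ge; exists [set` r]; first by split.
by rewrite fsbig_seq.
Qed.

Lemma esumZl (I : choiceType) (a : I -> \bar R) (c : R) : (0 <= c)%R ->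
  (forall i, 0 <= a i) ->
  \esum_(i in [set: I]) (c%:E * a i) = c%:E * \esum_(i in [set: I]) a i.
Proof.
move=> c0 a0.
have le (c' : R) (b : I -> \bar R) : (0 <= c')%R -> (forall i, 0 <= b i) ->
    \esum_(i in [set: I]) (c'%:E * b i) <= c'%:E * \esum_(i in [set: I]) b i.
  move=> c'0 b0; apply: esum_seq_le => r ur.
  rewrite -ge0_sume_distrr => [|i _]; last exact: b0.
  by rewrite lee_wpmul2l// ?lee_fin// esum_seq_ge.
apply/eqP; rewrite eq_le le//=.
have [->|cn0] := eqVneq c 0%R.
  by rewrite mul0e esum_ge0// => i _; rewrite mul0e.
have cgt0 : (0 < c)%R by rewrite lt0r cn0.
rewrite -lee_pdivlMl// -[leLHS](eq_esum (a := fun i => c^-1%:E * (c%:E * a i))).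
  by apply: le; [rewrite invr_ge0|move=> i; rewrite mule_ge0].
by move=> i _; rewrite muleA -EFinM mulVf// mul1e.
Qed.

End EsumTools.

(** * Bessel's inequality and the defect of Parseval's identity *)
Section Parseval.
Variable R : realType.
Local Notation mu := (@lebesgue_measure R).
Variables (b s : R).
Hypothesis b0 : 0 < b.
Local Notation T := (b^-1).
Local Notation W := (window b s).
Local Notation sq := (sqint mu W).
Local Notation "<< u , v >>" := (ip mu W u v).

Let mW : measurable (W : set (measurableTypeR R)). Proof. exact: measurable_window. Qed.
Let T0 : 0 < T. Proof. by rewrite invr_gt0. Qed.
Let sw m th : sq (wave b m th). Proof. exact: sqint_wave. Qed.
Hint Resolve sw : core.

Definition coef_energy (u : R -> R) (m : int) : R :=
  << u, wave b m 0 >> ^+ 2 + << u, wave b m (pi / 2) >> ^+ 2.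

(** The squared modulus of the m-th complex Fourier coefficient, summed over all
    integers m: for real u no factor 2 appears. *)
Definition energy (u : R -> R) : \bar R :=
  (\esum_(m in [set: int]) (coef_energy u m)%:E)%E.

Lemma coef_energy_ge0 u m : 0 <= coef_energy u m.
Proof. by rewrite addr_ge0 ?sqr_ge0. Qed.

Lemma wave_opp m th t : wave b (- m) th t = wave b m (- th) t.
Proof.
by rewrite /wave -cosN; congr cos; rewrite rmorphN; ring.
Qed.

Lemma coef_opp0 u k : << u, wave b (- k) 0 >> = << u, wave b k 0 >>.
Proof. by apply: eq_Rintegral => t _; rewrite wave_opp oppr0. Qed.

Lemma coef_opp_pihalf u k : sq u ->
  << u, wave b (- k) (pi / 2) >> = - << u, wave b k (pi / 2) >>.
Proof.
move=> su; rewrite ipC [in RHS]ipC -[RHS]mulN1r -ipZl//; apply: eq_Rintegral => t _.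
by rewrite wave_opp mulN1r /wave opprK cosBpihalf cosDpihalf.
Qed.

(** For p the sum over m in r of the waves of frequency m weighted by the
    coefficients of u, <p, u> is the sum of the coefficient energies, and
    <p, p> is at most T times that sum: the frequencies m and -m span the same
    plane, and each element of r meets itself and its opposite at most once.
    Expanding the square of T u - p gives the bound. *)
Lemma bessel_seq u (r : seq int) : sq u -> uniq r ->
  \sum_(m <- r) coef_energy u m <= T * << u, u >>.
Proof.
move=> su ur.
pose F m t := << u, wave b m 0 >> * wave b m 0 t +
  << u, wave b m (pi / 2) >> * wave b m (pi / 2) t.
have sF m : sq (F m) by apply: sqintD => //; apply: sqintZ.
have uF m : << F m, u >> = coef_energy u m.
  by rewrite ipDl//; try exact: sqintZ;
    rewrite !ipZl// ![<< wave b _ _, u >>]ipC /coef_energy -!expr2.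
have FF m k : << F m, F k >> = T / 2 * ((m == k)%:R + (m == - k)%:R) * coef_energy u k.
  have sFZ c k' th : sq (fun t => c * wave b k' th t) by exact: sqintZ.
  rewrite ipDl// !ipZl// ![<< wave b m _, F k >>]ipC !ipDl// !ipZl//.
  rewrite !ip_wave// !addr0 !sub0r !subr0 !add0r !subrr !cosN cos0 cos_pihalf.
  have -> : pi / 2 + pi / 2 = pi :> R by field.
  have -> : (k == - m) = (m == - k) by rewrite eq_sym eqr_oppLR.
  rewrite (eq_sym k m) cospi /coef_energy; have bn0 : b != 0 by rewrite gt_eqF.
  have [mk|_] := eqVneq m (- k); have [mk'|_] := eqVneq m k; rewrite /= ?mul0r ?mul1r.
  (* Here k = 0, and the sine coefficient vanishes. *)
  - have := coef_opp_pihalf k su; rewrite -{1}mk mk' => kk.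
    have -> : << u, wave b k (pi / 2) >> = 0 by lra.
    by field.
  - by rewrite mk coef_opp0 coef_opp_pihalf//; field.
  - by rewrite mk'; field.
  - by field.
pose p t := \sum_(m <- r) F m t.
have sp : sq p by exact: sqint_sum.
have pu : << p, u >> = \sum_(m <- r) coef_energy u m.
  by rewrite ip_suml//; apply: eq_bigr.
have pp : << p, p >> <= T * \sum_(m <- r) coef_energy u m.
  rewrite ip_suml// mulr_sumr (eq_bigr (fun m => \sum_(k <- r)
      T / 2 * ((k == m)%:R + (k == - m)%:R) * coef_energy u m)); last first.
    by move=> m _; rewrite ipC ip_suml//; apply: eq_bigr => k _; rewrite FF.
  apply: ler_sum => m _; rewrite -mulr_suml ler_wpM2r ?coef_energy_ge0// -mulr_sumr.
  rewrite mulrAC ler_pdivrMr// ler_pM2l// big_split/=.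
  have cnt (x : int) : \sum_(k <- r) (k == x)%:R <= 1 :> R.
    rewrite (eq_bigr (fun k => (nat_of_bool (k == x))%:R)) // -natr_sum -[1]/(1%:R) ler_nat.
    have -> : (\sum_(k <- r) (k == x) = count_mem x r)%N.
      by rewrite -sum1_count [RHS]big_mkcond; apply: eq_bigr => k _ /=; case: eqP.
    by rewrite count_uniq_mem//; case: (_ \in _).
  by rewrite -[2]/(1 + 1) lerD// cnt.
have := ip_ge0 mu W (fun t => T * u t - p t).
rewrite ipBl//; [|exact: sqintZ|by apply: sqintB => //; exact: sqintZ].
rewrite ipZl//; last by apply: sqintB => //; exact: sqintZ.
rewrite ![<< _, fun t => _ - _ >>]ipC !ipBl//; try exact: sqintZ.
rewrite !ipZl// pu [<< u, p >>]ipC pu => H.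
rewrite -(ler_pM2l T0); set X := << u, u >> in H *; set S := \sum_(m <- r) _ in H pp *.
nra.
Qed.

Lemma energy_le u : sq u -> (energy u <= (T * << u, u >>)%:E)%E.
Proof.
move=> su; apply: esum_seq_le => r ur; rewrite sumEFin lee_fin; exact: bessel_seq.
Qed.

Lemma energy_ge0 u : (0 <= energy u)%E.
Proof. by apply: esum_ge0 => m _; rewrite lee_fin coef_energy_ge0. Qed.

Lemma energy_fin u : sq u -> energy u \is a fin_num.
Proof.
move=> su; rewrite ge0_fin_numE; last exact: energy_ge0.
by apply: (le_lt_trans (energy_le su)); rewrite ltry.
Qed.

Definition defect u : R := T * << u, u >> - fine (energy u).

Lemma defect_ge0 u : sq u -> 0 <= defect u.
Proof.
by move=> su; rewrite subr_ge0 -lee_fin fineK ?energy_fin// energy_le.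
Qed.

Lemma defect_le u : defect u <= T * << u, u >>.
Proof. by rewrite gerBl fine_ge0// energy_ge0. Qed.

(** Both terms of the defect obey the parallelogram law.  As the defect is
    nonnegative, this alone makes the sum of two of its zeros a zero. *)
Lemma defect_parallelogram u v : sq u -> sq v ->
  defect (fun t => u t + v t) + defect (fun t => u t - v t) = 2 * defect u + 2 * defect v.
Proof.
move=> su sv; have suv := sqintD mW su sv; have suv' := sqintB mW su sv.
have E : (energy (fun t => u t + v t)%R + energy (fun t => u t - v t)%R =
    (energy u + energy u) + (energy v + energy v))%E.
  rewrite /energy -!esumD//; try by move=> *; rewrite ?adde_ge0// lee_fin coef_energy_ge0.
  apply: eq_esum => m _; rewrite -!EFinD /coef_energy !ipBl// !ipDl//.
  by congr EFin; ring.
have := congr1 fine E; rewrite !fineD ?fin_numD ?energy_fin// => {}E.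
rewrite /defect ipBl// [<< u, fun t => u t - _ >>]ipC [<< v, fun t => u t - _ >>]ipC !ipBl//.
rewrite ipDl// [<< u, fun t => u t + _ >>]ipC [<< v, fun t => u t + _ >>]ipC !ipDl//.
rewrite -(ipC mu W u v); lra.
Qed.

Lemma defectZ c u : sq u -> defect (fun t => c * u t) = c ^+ 2 * defect u.
Proof.
move=> su; have scu := sqintZ mW c su; rewrite /defect /energy.
rewrite (eq_esum (b := fun m => ((c ^+ 2)%:E * (coef_energy u m)%:E)%E)); last first.
  by move=> m _; rewrite /coef_energy !ipZl// -EFinM; congr EFin; ring.
rewrite esumZl ?sqr_ge0//; last by move=> m; rewrite lee_fin coef_energy_ge0.
rewrite -/(energy u) fineM// ?energy_fin// ipZl// [<< u, _ >>]ipC ipZl//=.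
by ring.
Qed.

Lemma energy_defect0 u : sq u -> defect u = 0 -> energy u = (T * << u, u >>)%:E.
Proof.
by move=> su /eqP; rewrite subr_eq0 => /eqP ->; rewrite fineK ?energy_fin.
Qed.

Definition parseval u := sq u /\ defect u = 0.

Lemma parsevalD u v : parseval u -> parseval v -> parseval (fun t => u t + v t).
Proof.
move=> [su du] [sv dv]; split; first exact: sqintD.
have := defect_parallelogram su sv; rewrite du dv.
by have := defect_ge0 (sqintD mW su sv); have := defect_ge0 (sqintB mW su sv); lra.
Qed.

Lemma parsevalZ c u : parseval u -> parseval (fun t => c * u t).
Proof.
by move=> [su du]; split; [exact: sqintZ|rewrite defectZ// du mulr0].
Qed.

Lemma parsevalB u v : parseval u -> parseval v -> parseval (fun t => u t - v t).
Proof.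
move=> pu pv; have := parsevalD pu (parsevalZ (-1) pv).
by congr parseval; apply/funext => t; rewrite mulN1r.
Qed.

(** The parallelogram law for u - v and v gives
    defect u <= 2 defect (u - v) <= 2 T ||u - v||^2 when the defect of v is 0. *)
Lemma parseval_closed u : sq u ->
  (forall e, 0 < e -> exists2 v, parseval v & << fun t => u t - v t, fun t => u t - v t >> <= e) ->
  parseval u.
Proof.
move=> su app; split=> //; apply/eqP; rewrite eq_le defect_ge0// andbT.
apply/ler_addgt0Pl => e e0; rewrite addr0.
have [|v [sv dv] uv] := app (e / (2 * T)); first by rewrite divr_gt0// mulr_gt0.
have suv := sqintB mW su sv.
have := defect_parallelogram suv sv; rewrite dv.
have -> : (fun t => u t - v t + v t) = u by apply/funext => t; rewrite subrK.
have := defect_ge0 (sqintB mW suv sv).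
have := defect_le (fun t => u t - v t).
have : T * << fun t => u t - v t, fun t => u t - v t >> <= e / 2.
  rewrite -ler_pdivlMl//; apply: (le_trans uv); rewrite le_eqVlt; apply/orP; left.
  by apply/eqP; field; rewrite gt_eqF.
lra.
Qed.

Lemma parseval_eq u v : measurable_fun [set: R] v -> (forall t, W t -> u t = v t) ->
  parseval u -> parseval v.
Proof.
move=> mv uv [[mu_ iu] du]; split; first split=> //.
  by apply: eq_integrable iu => // t; rewrite inE => /uv /= ->.
have E w : << v, w >> = << u, w >>.
  by apply: eq_Rintegral => t; rewrite inE => /uv ->.
rewrite -du /defect E ipC E; congr (_ - fine _).
by apply: eq_esum => m _; rewrite /coef_energy !E.
Qed.

Lemma parseval_dominated (u h : R -> R) (v : (R -> R)^nat) :
  (forall n, parseval (v n)) -> measurable_fun [set: R] u -> sq h ->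
  (forall t, W t -> v ^~ t @ \oo --> u t) ->
  (forall n t, W t -> `|v n t| <= h t) -> parseval u.
Proof.
move=> pv mu_ sh vu vh.
have uh t : W t -> `|u t| <= h t.
  move=> Wt; have vut : (fun n => `|v n t|) @ \oo --> `|u t|.
    by apply: cvg_norm; exact: vu.
  rewrite -(cvg_lim _ vut)//; apply: limr_le; first by apply/cvg_ex; eexists; exact: vut.
  by apply: nearW => n; exact: vh.
have su : sq u.
  split=> //; case: (sh) => mh ih; apply: le_integrable ih => //.
    by apply/measurable_EFinP/measurable_funTS; exact: measurable_funX.
  move=> t Wt /=; rewrite lee_fin !normrX lerXn2r ?nnegrE// (le_trans (uh t Wt))//.
  exact: ler_norm.
apply: parseval_closed => // e e0.
have mB n : measurable_fun [set: R] (fun t => u t - v n t).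
  by apply: measurable_funB => //; case: (pv n) => -[].
have domH : (forall t, W t -> forall n, ((u t - v n t) ^+ 2)%R <= (4 * h t ^+ 2)%R).
  move=> t Wt n; rewrite -real_normK ?num_real//.
  have : `|u t - v n t| <= 2 * h t.
    by rewrite (le_trans (ler_normB _ _))// mulr_natl mulr2n lerD ?uh ?vh.
  by have := normr_ge0 (u t - v n t); nra.
have [|||||_ _ +] := @dominated_convergence _ _ _ mu W mW
  (fun n t => ((u t - v n t) ^+ 2)%:E) (cst 0%E) (fun t => (4 * h t ^+ 2)%:E).
- by move=> n; apply/measurable_EFinP/measurable_funTS; apply: measurable_funX; exact: mB.
- exact: measurable_cst.
- apply/aeW => t Wt.
  have cv : (fun n => (u t - v n t) ^+ 2) @ \oo --> (0 : R).
    have c0 : (fun n => u t - v n t) @ \oo --> (0 : R).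
      by rewrite -(subrr (u t)); apply: cvgB; [exact: cvg_cst|exact: vu].
    by rewrite -(mulr0 0); under eq_fun do rewrite expr2; exact: cvgM.
  exact: (cvg_comp _ _ cv).
- exact: (integrableZl mW 4 sh.2).
- apply/aeW => t n Wt; rewrite gee0_abs ?lee_fin ?sqr_ge0//; exact: domH.
rewrite integral_cst// mul0e => /fine_cvg /cvgrPdist_le /(_ e e0) [N _ /(_ N (leqnn N))] /=.
rewrite sub0r normrN => H; exists (v N) => //; rewrite (le_trans _ H)// (le_trans _ (ler_norm _))//.
Qed.

End Parseval.

(** * Polynomials that converge to the indicator of [0, 1/2[ *)
Section Cutoff.
Variable R : realType.

(** The exponents are chosen so that the limit is also 0 at v = 1/2: n 2^(n^2)
    v^(n^2) is at least n for v >= 1/2, and tends to 0 for v < 1/2, because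
    (2v)^(n^2) decays at least like 1/n^2. *)
Definition cutoff (n : nat) (v : R) : R := (1 - v ^+ (n ^ 2)) ^+ (n * 2 ^ (n ^ 2)).

Lemma cutoff_le1 n (v : R) : 0 <= v <= 1 -> 0 <= cutoff n v <= 1.
Proof.
move=> /andP[v0 v1]; have vn0 : 0 <= v ^+ (n ^ 2) by rewrite exprn_ge0.
have vn1 : v ^+ (n ^ 2) <= 1 by rewrite exprn_ile1.
by rewrite /cutoff exprn_ge0 ?subr_ge0//= exprn_ile1 ?subr_ge0// gerBl.
Qed.

Lemma bernoulli_ineq (x : R) n : -1 <= x -> 1 + n%:R * x <= (1 + x) ^+ n.
Proof.
move=> x1; elim: n => [|n IH]; first by rewrite mul0r addr0 expr0.
rewrite exprS; apply: (le_trans _ (ler_wpM2l _ IH)); last lra.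
rewrite -natr1; have : 0 <= n%:R * x ^+ 2 by rewrite mulr_ge0 ?sqr_ge0.
nra.
Qed.

(** (1 - x)^N (1 + x)^N <= 1 reduces the claim to Bernoulli's inequality. *)
Lemma cutoff_ge (v : R) n : 2^-1 <= v <= 1 -> cutoff n.+1 v <= n.+1%:R^-1.
Proof.
move=> /andP[v0 v1]; rewrite /cutoff.
set x := v ^+ _; set N := (n.+1 * _)%N.
have x0 : 0 <= x by rewrite exprn_ge0// (le_trans _ v0).
have x1 : x <= 1 by rewrite exprn_ile1// (le_trans _ v0).
have h1 : (1 - x) ^+ N * (1 + x) ^+ N <= 1.
  by rewrite -exprMn exprn_ile1//; nra.
have h2 : n.+1%:R <= (1 + x) ^+ N.
  apply: (le_trans _ (bernoulli_ineq _ _)); last lra.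
  rewrite /N natrM -mulrA natrX.
  suff : 1 <= 2 ^+ (n.+1 ^ 2) * x by have : 0 <= n.+1%:R :> R by []; nra.
  by rewrite -exprMn exprn_ege1//; lra.
rewrite -[leRHS]mul1r ler_pdivlMr//; apply: le_trans h1.
by rewrite ler_wpM2l// exprn_ge0// subr_ge0.
Qed.

(** Bernoulli's inequality applies twice: to the outer power, and to bound
    (2v)^(n^2) by means of (2v)(1 + h) <= 1 for h = 1 - 2v. *)
Lemma cutoff_lt (v : R) n : 0 <= v < 2^-1 ->
  1 - (1 - 2 * v)^-1 * n.+1%:R^-1 <= cutoff n.+1 v.
Proof.
move=> /andP[v0 v1]; rewrite /cutoff.
set x := v ^+ _; set N := (n.+1 * _)%N.
have x0 : 0 <= x by rewrite exprn_ge0.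
have x1 : x <= 1 by rewrite exprn_ile1//; lra.
apply: le_trans (bernoulli_ineq (x := - x) _ _); last lra.
rewrite mulrN lerD2l lerN2 /N natrM -mulrA natrX -exprMn.
set h := 1 - 2 * v; have h0 : 0 < h by rewrite /h; lra.
have h1 : (2 * v) ^+ (n.+1 ^ 2) * (1 + h) ^+ (n.+1 ^ 2) <= 1.
  by rewrite -exprMn exprn_ile1// /h; nra.
have h2 : n.+1%:R ^+ 2 * h <= (1 + h) ^+ (n.+1 ^ 2).
  apply: (le_trans _ (bernoulli_ineq _ _)); last lra.
  by rewrite natrX lerDr.
rewrite -invfM -[leRHS]mul1r ler_pdivlMr ?mulr_gt0//; apply: le_trans h1.
rewrite [leLHS](_ : _ = (2 * v) ^+ (n.+1 ^ 2) * (n.+1%:R ^+ 2 * h)); last by ring.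
by rewrite ler_wpM2l// exprn_ge0// mulr_ge0.
Qed.

Lemma cvg_cutoff (v : R) : 0 <= v <= 1 ->
  cutoff ^~ v @ \oo --> ((v < 2^-1)%R%:R : R).
Proof.
move=> /andP[v0 v1]; rewrite -(cvg_shiftS (cutoff ^~ v)).
have cinv (c : R) : (fun n : nat => c * n.+1%:R^-1) @ \oo --> 0.
  by rewrite -(mulr0 c); apply: cvgM; [exact: cvg_cst|exact: cvg_harmonic].
case: ltP => v2.
  apply: (@squeeze_cvgr _ _ _ _ (fun n => 1 - (1 - 2 * v)^-1 * n.+1%:R^-1) (fun=> 1)).
  - apply: nearW => n; rewrite cutoff_lt ?v0//=.
    by have /andP[] := @cutoff_le1 n.+1 v (introT andP (conj v0 v1)).
  - by rewrite -[X in _ --> X]subr0; apply: cvgB; [exact: cvg_cst|exact: cinv].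
  - exact: cvg_cst.
apply: (@squeeze_cvgr _ _ _ _ (fun=> 0) (fun n => n.+1%:R^-1)).
- apply: nearW => n; rewrite cutoff_ge ?v2//.
  by have /andP[->] := @cutoff_le1 n.+1 v (introT andP (conj v0 v1)).
- exact: cvg_cst.
- exact: cvg_harmonic.
Qed.

End Cutoff.

(** * Parseval's identity *)
Section Density.
Variable R : realType.
Local Notation mu := (@lebesgue_measure R).
Variables (b s : R).
Hypothesis b0 : 0 < b.
Local Notation T := (b^-1).
Local Notation W := (window b s).
Local Notation sq := (sqint mu W).
Local Notation "<< u , v >>" := (ip mu W u v).
Local Notation parseval := (parseval b s).

Let mW : measurable (W : set (measurableTypeR R)). Proof. exact: measurable_window. Qed.
Let T0 : 0 < T. Proof. by rewrite invr_gt0. Qed.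
Let sw m th : sq (wave b m th). Proof. exact: sqint_wave. Qed.
Hint Resolve sw : core.

(** By Bessel's inequality it suffices to sum the coefficient energies at the
    frequencies k and -k, which coincide if k = 0. *)
Lemma parseval_wave k th : parseval (wave b k th).
Proof.
split=> //; apply/eqP; rewrite eq_le defect_ge0// andbT subr_le0 -lee_fin.
rewrite fineK ?energy_fin//.
have bn0 : b != 0 by rewrite gt_eqF.
have E m : coef_energy b s (wave b k th) m =
    (T / 2) ^+ 2 * ((m == k)%:R + (m == - k)%:R +
     2 * (m == k)%:R * (m == - k)%:R * cos (th *+ 2)).
  rewrite /coef_energy !ip_wave// addr0 subr0 cosDpihalf cosBpihalf.
  have -> : (k == - m) = (m == - k) by rewrite eq_sym eqr_oppLR.
  rewrite (eq_sym k m) cos_mulr2n mulr2n.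
  have := sin2cos2 th; set S := sin th; set C := cos th => SC.
  by case: (m == k); case: (m == - k);
    rewrite /= ?mul0r ?mul1r ?addr0 ?add0r ?mulr1 ?mulr0 //; ring: SC.
have [k0|k0] := eqVneq k 0.
  apply: (le_trans _ (@esum_seq_ge _ _ _ [:: 0] _)) => //.
  rewrite big_seq1 lee_fin E ip_wave// k0 oppr0 !eqxx subrr cos0 -mulr2n.
  by rewrite le_eqVlt; apply/orP; left; apply/eqP => /=; field.
have kk : k != - k.
  by rewrite -subr_eq0 opprK -mulr2n mulrn_eq0.
apply: (le_trans _ (@esum_seq_ge _ _ _ [:: k; - k] _)); last by rewrite /= inE kk.
rewrite big_cons big_seq1 lee_fin !E ip_wave// !eqxx (negbTE kk) eq_sym (negbTE kk) subrr cos0.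
by rewrite le_eqVlt; apply/orP; left; apply/eqP => /=; field.
Qed.

Inductive trigpoly : (R -> R) -> Prop :=
| trigpoly_wave m th : trigpoly (wave b m th)
| trigpoly_lin c f g : trigpoly f -> trigpoly g -> trigpoly (fun t => c * f t + g t).

Lemma parseval_trigpoly f : trigpoly f -> parseval f.
Proof.
elim=> [m th|c f' g _ pf _ pg]; first exact: parseval_wave.
by apply: parsevalD => //; exact: parsevalZ.
Qed.

Lemma trigpoly_ext f g : f =1 g -> trigpoly f -> trigpoly g.
Proof. by move=> /funext ->. Qed.

Lemma trigpoly_mul f g : trigpoly f -> trigpoly g -> trigpoly (fun t => f t * g t).
Proof.
move=> tf; elim: tf g => [m th|c f1 f2 _ H1 _ H2] g tg; last first.
  have := trigpoly_lin c (H1 g tg) (H2 g tg).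
  by apply: trigpoly_ext => t; ring.
elim: tg => [k ph|c g1 g2 _ H1 _ H2]; last first.
  by have := trigpoly_lin c H1 H2; apply: trigpoly_ext => t; ring.
have := trigpoly_lin 2^-1 (trigpoly_wave (m + k) (th + ph))
  (trigpoly_lin (- 2^-1) (trigpoly_wave (m - k) (th - ph)) (trigpoly_wave (m - k) (th - ph))).
by apply: trigpoly_ext => t; rewrite wave_mul; field.
Qed.

Lemma trigpoly_cst c : trigpoly (fun=> c).
Proof.
have := trigpoly_lin (c - 1) (trigpoly_wave 0 0) (trigpoly_wave 0 0).
apply: trigpoly_ext => t; rewrite /wave !(mul0r, mulr0) subr0 cos0; ring.
Qed.

Lemma trigpoly_exp f n : trigpoly f -> trigpoly (fun t => f t ^+ n).
Proof.
move=> tf; elim: n => [|n IH]; first exact: trigpoly_cst.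
by have := trigpoly_mul tf IH; apply: trigpoly_ext => t; rewrite exprS.
Qed.

Lemma trigpoly_cutoff f n : trigpoly f -> trigpoly (fun t => cutoff n (f t)).
Proof.
move=> tf; apply: trigpoly_exp.
have := trigpoly_lin (-1) (trigpoly_exp (n ^ 2) tf) (trigpoly_cst 1).
by apply: trigpoly_ext => t; ring.
Qed.

(** For s < x < s + T the trace of the ray is the arc of centre (s + x) / 2 and
    half-length (x - s) / 2.  There the wave centred at (s + x) / 2 exceeds its
    value at the end points, that is, v < 1/2, so [cutoff n] of v converges
    to the indicator. *)
Lemma parseval_ray x : parseval (\1_(`]-oo, x[%classic)).
Proof.
have mray : measurable (`]-oo, x[%classic : set R) by [].
have mind : measurable_fun [set: R] (\1_(`]-oo, x[%classic) : R -> R).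
  exact: measurable_indic.
have [xs|sx] := leP x s.
  apply: (@parseval_eq _ b s (fun=> 0)) => //.
    move=> t; rewrite /window/= in_itv/= => /andP[st _].
    rewrite indicE memNset//= in_itv/=; apply/negP; rewrite -leNgt;
    exact: (le_trans xs (ltW st)).
  exact/parseval_trigpoly/trigpoly_cst.
have [Tx|xT] := leP (s + T) x.
  apply: (@parseval_eq _ b s (fun=> 1)) => //.
    move=> t; rewrite /window/= in_itv/= => /andP[_ tT].
    rewrite indicE mem_set//= in_itv/=; exact: (lt_le_trans tT Tx).
  exact/parseval_trigpoly/trigpoly_cst.
pose v t := 2^-1 + 4^-1 * (cos (pi * b * (x - s)) - wave b 1 (pi * b * (s + x)) t).
have tv : trigpoly v.
  have := trigpoly_lin (- 4^-1) (trigpoly_wave 1 (pi * b * (s + x)))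
    (trigpoly_cst (2^-1 + 4^-1 * cos (pi * b * (x - s)))).
  by apply: trigpoly_ext => t; rewrite /v; ring.
have v01 t : 0 <= v t <= 1.
  rewrite /v /wave; set X := cos _; set Y := cos _.
  have := cos_geN1 (pi * b * (x - s)); have := cos_le1 (pi * b * (x - s)).
  have : -1 <= Y <= 1 by rewrite cos_geN1 cos_le1.
  rewrite -/X; lra.
have key t : W t -> (v t < 2^-1) = (t < x).
  rewrite /window/= in_itv/= => /andP[st tT].
  have bpi : 0 < pi * b by rewrite mulr_gt0// pi_gt0.
  have Tb : T * b = 1 by rewrite mulVf// gt_eqF.
  have piTb : pi * b * T = pi by rewrite -mulrA [b * T]mulrC Tb mulr1.
  have -> : (v t < 2^-1) = (cos (pi * b * (x - s)) < cos (pi * b * (2 * t - s - x))).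
    rewrite /v /wave [2 * pi * _ * t - _](_ : _ = pi * b * (2 * t - s - x)); last by ring.
    apply/idP/idP; lra.
  have in0pi y : 0 <= y -> y <= T -> pi * b * y \in `[0, pi].
    by move=> y0 yT; rewrite in_itv/= mulr_ge0 ?(ltW bpi)//= -{2}piTb ler_pM2l.
  have coslt y z : 0 <= z -> z < y -> y <= T -> cos (pi * b * y) < cos (pi * b * z).
    move=> z0 zy yT; have yI : pi * b * y \in `[0, pi] by apply: in0pi; lra.
    have zI : pi * b * z \in `[0, pi] by apply: in0pi; lra.
    by rewrite ltr_cos// ltr_pM2l.
  have cosle y z : 0 <= z -> z <= y -> y <= T -> cos (pi * b * y) <= cos (pi * b * z).
    by move=> z0; rewrite le_eqVlt => /predU1P[->//|zy yT]; rewrite ltW ?coslt.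
  case: (leP x t) => xt.
    apply/negbTE; rewrite -leNgt.
    have [y1|y1] := leP (2 * t - s - x) T; first by apply: cosle => //; lra.
    (* Beyond half a turn, reflect the angle into [0, pi]. *)
    have -> : cos (pi * b * (2 * t - s - x)) = cos (pi * b * (2 * T - (2 * t - s - x))).
      rewrite -[LHS]cosN -[LHS](cosDint 1); congr cos; set y := 2 * t - s - x.
      have -> : pi * b * (2 * T - y) = 2 * (pi * b * T) - pi * b * y by ring.
      by rewrite piTb; ring.
    by apply: cosle; lra.
  have [y0|y0] := leP 0 (2 * t - s - x); first by apply: coslt; lra.
  by rewrite -[ltRHS]cosN -mulrN; apply: coslt; lra.
apply: (@parseval_dominated _ b s b0 _ (fun=> 1) (fun n t => cutoff n (v t))) => //.
- by move=> n; apply/parseval_trigpoly/trigpoly_cutoff.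
- by case: (parseval_trigpoly (trigpoly_cst 1)).
- move=> t Wt; rewrite (_ : \1__ t = (v t < 2^-1)%R%:R); first exact: cvg_cutoff.
  by rewrite indicE key//; congr (nat_of_bool _)%:R; apply/idP/idP; rewrite inE/= in_itv.
- move=> n t _; have /andP[c0 c1] := cutoff_le1 n (v01 t).
  by rewrite ger0_norm.
Qed.

(** Rays form a pi-system that generates the Borel sets, and the sets whose
    indicator satisfies Parseval's identity form a lambda-system. *)
Lemma parseval_indic (E : set R) : measurable E -> parseval (\1_E).
Proof.
move=> mE; have {}mE : (@RGenInftyO.G R).-sigma.-measurable E.
  by rewrite -RGenInftyO.measurableE.
suff [] : measurable E /\ parseval (\1_E) by [].
move: E mE; apply: lambda_system_subset => //.
- by move=> _ _ [x ->] [y ->]; exists (Num.min x y);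
    apply/seteqP; split => t /=; rewrite !in_itv/= lt_min; [move=> [-> ->]|move=> /andP[-> ->]].
- have pT : parseval (\1_[set: R]).
    apply: (parseval_eq _ _ (parseval_trigpoly (trigpoly_cst 1))).
      exact: measurable_indic.
    by move=> t _; rewrite indicT.
  split => //.
  + move=> A B BA [mA pA] [mB pB]; split; first exact: measurableD.
    have := parsevalB b0 pA pB; congr parseval; apply/funext => t.
    rewrite !indicE in_setD; case: (boolP (t \in B)) => tB; last by rewrite andbT subr0.
    by rewrite (_ : t \in A) ?subrr//; move: tB; rewrite !inE; exact: BA.
  + move=> F ndF mpF; have mF : measurable (\bigcup_i F i).
      by apply: bigcup_measurable => i _; case: (mpF i).
    split=> //; apply: (@parseval_dominated _ b s b0 _ (fun=> 1) (fun n => \1_(F n))).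
    * by move=> n; case: (mpF n).
    * exact: measurable_indic.
    * by case: (parseval_trigpoly (trigpoly_cst 1)).
    * move=> t Wt; rewrite indicE; have [/set_mem [N _ FNt]|tF] := boolP (t \in _).
        apply: cvg_near_cst; exists N => // n /= Nn; rewrite indicE mem_set//.
        by move: FNt; apply/subsetPset/ndF.
      apply: cvg_near_cst; apply: nearW => n; rewrite indicE memNset// => Fnt.
      by move: tF; rewrite notin_setE; apply; exists n.
    * by move=> n t _; rewrite indicE; case: (_ \in _); rewrite ?normr1 ?normr0.
- move=> _ [x ->]; split=> //; exact: parseval_ray.
Qed.

Lemma parseval_sum (I : Type) (r : seq I) (F : I -> R -> R) :
  (forall i, parseval (F i)) -> parseval (fun t => \sum_(i <- r) F i t).
Proof.
move=> pF; elim: r => [|i r IH].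
  have := parseval_trigpoly (trigpoly_cst 0); congr parseval.
  by apply/funext => t; rewrite big_nil.
have := parsevalD b0 (pF i) IH; congr parseval.
by apply/funext => t; rewrite big_cons.
Qed.

Import HBNNSimple.

Lemma parseval_nnsfun (f : {nnsfun R >-> R}) : parseval f.
Proof.
have -> : (f : R -> R) = fun t => \sum_(y <- fset_set (range f)) y * \1_(f @^-1` [set y]) t.
  apply/funext => t; rewrite fimfunE fsbig_finite//; exact: fimfunP.
by apply: parseval_sum => y; apply: parsevalZ => //; apply: parseval_indic.
Qed.

Lemma parseval_sqint (u : R -> R) : sq u -> parseval u.
Proof.
have pos w : sq w -> (forall t, 0 <= w t) -> parseval w.
  move=> sw0 w0; have [mw iw] := sw0.
  have mw' : measurable_fun [set: R] (EFin \o w) by apply/measurable_EFinP.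
  pose f := nnsfun_approx measurableT mw'.
  have cf t : f ^~ t @ \oo --> w t.
    have h : forall x, [set: R] x -> (0 <= (EFin \o w) x)%E by move=> x _; rewrite lee_fin.
    have := @cvg_nnsfun_approx _ _ _ _ measurableT _ mw' h t Logic.I.
    by move/fine_cvgP => [].
  apply: (@parseval_dominated _ b s b0 _ w (fun n => f n)) => //.
    by move=> n; exact: parseval_nnsfun.
  move=> n t _; rewrite ger0_norm//.
  rewrite -(cvg_lim _ (cf t))//; apply: nondecreasing_cvgn_le.
    move=> m k mk; have := @nd_nnsfun_approx _ _ _ _ measurableT _ mw' m k mk.
    by move/lefP/(_ t).
  by apply/cvg_ex; eexists; exact: cf.
move=> su; have [mu_ iu] := su.
have part (p : R -> R) : measurable_fun [set: R] p -> (forall t, 0 <= p t <= `|u t|) -> parseval p.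
  move=> mp pu; apply: pos; last by move=> t; case/andP: (pu t).
  split=> //; apply: le_integrable iu => //.
    by apply/measurable_EFinP/measurable_funTS; exact: measurable_funX.
  move=> t _ /=; rewrite lee_fin !normrX lerXn2r ?nnegrE//.
  by have /andP[p0 p1] := pu t; rewrite ger0_norm.
have pp : parseval (fun t => Num.max (u t) 0).
  apply: part; first exact: measurable_maxr.
  by move=> t; rewrite le_max lexx orbT ge_max ler_norm normr_ge0.
have pn : parseval (fun t => Num.max (- u t) 0).
  apply: part; first by apply: measurable_maxr => //; exact: measurableT_comp.
  by move=> t; rewrite le_max lexx orbT ge_max -normrN ler_norm normr_ge0.
have := parsevalB b0 pp pn; congr parseval; apply/funext => t.
by rewrite /Num.max; case: ltP => u0; case: ltP => u1; lra.
Qed.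

Lemma parseval_identity (u : R -> R) : sq u ->
  energy b s u = (T * << u, u >>)%:E.
Proof. by move=> /parseval_sqint[su du]; exact: energy_defect0. Qed.

End Density.

(** * Translations and countable families over the integers *)
Section Translation.
Variable R : realType.
Local Notation mu := (@lebesgue_measure R).

Lemma measurable_subr (c : R) : measurable_fun [set: R] (fun t : R => t - c).
Proof. by apply: measurable_funB. Qed.

Lemma lebesgue_measure_shift (c : R) (A : set R) : measurable A ->
  pushforward mu ((fun t => t - c) : _ -> measurableTypeR R) A = mu A.
Proof.
pose phi : measurableTypeR R -> measurableTypeR R := fun t : R => t - c.
have mphi : measurable_fun [set: measurableTypeR R] phi by exact: measurable_subr.
pose m := isMeasurableFun.Build _ _ _ _ _ mphi.
pose p : {mfun measurableTypeR R >-> measurableTypeR R} := HB.pack phi m.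
move=> mA; apply/esym; apply: (@lebesgue_measure_unique R (pushforward mu p)) => //= _ [[x y]] _ <-.
rewrite /pushforward (_ : _ @^-1` _ = `]x + c, y + c]%classic); last first.
  by apply/seteqP; split=> t /=; rewrite !in_itv/= ltrBrDr lerBlDr.
rewrite !lebesgue_measure_itv/= !lte_fin ltrD2r; case: ifP => // _.
by rewrite -!EFinB; congr EFin; ring.
Qed.

Lemma ge0_integral_shift (c : R) (f : R -> \bar R) :
  measurable_fun [set: R] f -> (forall t, (0 <= f t)%E) ->
  (\int[mu]_t f (t - c)%R = \int[mu]_t f t)%E.
Proof.
move=> mf f0; pose phi : measurableTypeR R -> measurableTypeR R := fun t : R => t - c.
have mphi : measurable_fun [set: measurableTypeR R] phi by exact: measurable_subr.
have := @ge0_integral_pushforward _ _ (measurableTypeR R) (measurableTypeR R) R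
  phi mphi mu setT f measurableT mf.
rewrite preimage_setT => <-; last by move=> t _.
apply: eq_measure_integral => A mA _; exact: lebesgue_measure_shift.
Qed.

Lemma ae_mono (P Q : R -> Prop) : (forall t, P t -> Q t) ->
  {ae mu, forall t, P t} -> {ae mu, forall t, Q t}.
Proof.
move=> PQ [N [mN N0 PN]]; exists N; split=> // t nQ.
by apply: PN => /= Pt; apply: nQ; exact: PQ.
Qed.

Lemma ae_mono2 (P Q S : R -> Prop) : (forall t, P t -> Q t -> S t) ->
  {ae mu, forall t, P t} -> {ae mu, forall t, Q t} -> {ae mu, forall t, S t}.
Proof.
move=> PQS [N [mN N0 PN]] [M [mM M0 QM]]; exists (N `|` M); split.
- exact: measurableU.
- by rewrite null_set_setU.
- move=> t nS; have [Pt|nP] := pselect (P t); last by left; exact: PN.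
  by right; apply: QM => /= Qt; apply: nS; exact: PQS.
Qed.

Lemma ae_shift (c : R) (P : R -> Prop) :
  {ae mu, forall t, P t} -> {ae mu, forall t, P (t - c)}.
Proof.
move=> [N [mN N0 PN]]; exists ((fun t => t - c) @^-1` N); split.
- by rewrite -[_ @^-1` _]setTI; exact: measurable_subr.
- by rewrite -N0; exact: (lebesgue_measure_shift c mN).
- by move=> t /= nP; exact: PN.
Qed.

Lemma int_of_nat_surj (n : int) : exists k, int_of_nat k = n.
Proof.
by have [_ _ /(_ n I)[k _ <-]] := int_of_nat_bij; exists k.
Qed.

Lemma ae_forall_int (P : int -> R -> Prop) :
  (forall n, {ae mu, forall t, P n t}) -> {ae mu, forall t, forall n, P n t}.
Proof.
move=> aeP; have := ae_foralln (fun k => aeP (int_of_nat k)).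
by apply: filterS => t H n; have [k <-] := int_of_nat_surj n.
Qed.

Lemma integral_esum_int (D : set R) (f : int -> R -> \bar R) : measurable D ->
  (forall n, measurable_fun [set: R] (f n)) -> (forall n t, (0 <= f n t)%E) ->
  (\int[mu]_(t in D) (\esum_(n in [set: int]) f n t) =
   \esum_(n in [set: int]) (\int[mu]_(t in D) f n t))%E.
Proof.
move=> mD mf f0; rewrite esum_int; last by move=> n; exact: integral_ge0.
under eq_integral do rewrite esum_int//.
by rewrite integral_nneseries// => n; apply: measurable_funTS; exact: mf.
Qed.

Lemma measurable_esum_int (f : int -> R -> \bar R) :
  (forall n, measurable_fun [set: R] (f n)) -> (forall n t, (0 <= f n t)%E) ->
  measurable_fun [set: R] (fun t => \esum_(n in [set: int]) f n t)%E.
Proof.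
move=> mf f0; under eq_fun do rewrite esum_int//.
exact: ge0_emeasurable_sum.
Qed.

End Translation.

(** * Complex functions through their real and imaginary parts *)
Section Complex.
Variable R : realType.
Local Notation mu := (@lebesgue_measure R).
Implicit Types (f k : R -> R[i]) (z w : R[i]).
Local Open Scope complex_scope.

Lemma sqr_Cnorm z : Cnorm z ^+ 2 = complex.Re z ^+ 2 + complex.Im z ^+ 2.
Proof. by case: z => x y; rewrite /Cnorm/= sqr_sqrtr// addr_ge0 ?sqr_ge0. Qed.

Lemma Cnorm_ge0 z : 0 <= Cnorm z.
Proof. by case: z => x y; exact: sqrtr_ge0. Qed.

Lemma sqr_CnormM z w : Cnorm (z * w) ^+ 2 = Cnorm z ^+ 2 * Cnorm w ^+ 2.
Proof. by rewrite /Cnorm ComplexField.Normc.normcM exprMn. Qed.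

Definition sqnorm f : \bar R := (\int[mu]_t (Cnorm (f t) ^+ 2)%:E)%E.

Lemma sqr_CLnorm2 f : (CLnorm 2%:E f ^+ 2 = sqnorm f)%E.
Proof.
rewrite expe2 /CLnorm.
have N0 := Lnorm_ge0 mu 2%:E (EFin \o (@Cnorm R \o f)).
transitivity ('N[mu]_2%:E[EFin \o (@Cnorm R \o f)] `^ 2)%E.
  move: N0; case: ('N[mu]_2%:E[_])%E => [x|_|//]; last by rewrite poweRyr.
  by rewrite lee_fin => x0; rewrite poweR_EFin powR_mulrn// -EFinM expr2.
rewrite poweR_Lnorm//; apply: eq_integral => t _ /=.
by rewrite powR_mulrn// real_normK// num_real.
Qed.

Lemma measurable_sqr_Cnorm f : Cmeasurable f ->
  measurable_fun [set: R] (fun t => Cnorm (f t) ^+ 2).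
Proof.
move=> [m1 m2]; under eq_fun do rewrite sqr_Cnorm.
by apply: measurable_funD; apply: measurable_funX.
Qed.

Lemma sqnorm_ge0 f : (0 <= sqnorm f)%E.
Proof. by apply: integral_ge0 => t _; rewrite lee_fin sqr_ge0. Qed.

Lemma Cmeasurable_translation c f : Cmeasurable f -> Cmeasurable (translation c f).
Proof.
move=> [m1 m2]; split.
  exact: (measurableT_comp m1 (measurable_subr c)).
exact: (measurableT_comp m2 (measurable_subr c)).
Qed.

(** [reP f k] and [imP f k] are the real and imaginary parts of f times the
    conjugate of k. *)
Definition reP f k t :=
  complex.Re (f t) * complex.Re (k t) + complex.Im (f t) * complex.Im (k t).
Definition imP f k t :=
  complex.Im (f t) * complex.Re (k t) - complex.Re (f t) * complex.Im (k t).

Lemma measurable_reP f k : Cmeasurable f -> Cmeasurable k ->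
  measurable_fun [set: R] (reP f k).
Proof.
move=> [? ?] [? ?]; apply: measurable_funD; exact: measurable_funM.
Qed.

Lemma measurable_imP f k : Cmeasurable f -> Cmeasurable k ->
  measurable_fun [set: R] (imP f k).
Proof.
move=> [? ?] [? ?]; apply: measurable_funB; exact: measurable_funM.
Qed.

Lemma sqr_reP_imP f k t :
  reP f k t ^+ 2 + imP f k t ^+ 2 = Cnorm (f t) ^+ 2 * Cnorm (k t) ^+ 2.
Proof. by rewrite !sqr_Cnorm /reP /imP; ring. Qed.

Lemma sqr_inner f k : Cnorm (inner f k) ^+ 2 =
  (\int[mu]_t reP f k t) ^+ 2 + (\int[mu]_t imP f k t) ^+ 2.
Proof.
rewrite sqr_Cnorm /inner /Cintegral/=; congr (_ ^+ 2 + _ ^+ 2);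
  by apply: eq_Rintegral => t _; rewrite /reP /imP;
    case: (f t) => ? ?; case: (k t) => ? ? /=; ring.
Qed.

Lemma reP_modulation f k b (m : int) t : reP f (modulation (m%:~R * b) k) t =
  reP f k t * wave b m 0 t + imP f k t * wave b m (pi / 2) t.
Proof.
rewrite /reP /imP /modulation /expi /wave subr0 cosBpihalf.
case: (f t) => ? ?; case: (k t) => ? ? /=.
ring.
Qed.

Lemma imP_modulation f k b (m : int) t : imP f (modulation (m%:~R * b) k) t =
  imP f k t * wave b m 0 t - reP f k t * wave b m (pi / 2) t.
Proof.
rewrite /reP /imP /modulation /expi /wave subr0 cosBpihalf.
case: (f t) => ? ?; case: (k t) => ? ? /=.
ring.
Qed.

Lemma sqr_Cnorm_modulation c f t : Cnorm (modulation c f t) ^+ 2 = Cnorm (f t) ^+ 2.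
Proof.
by rewrite sqr_CnormM [X in X * _]sqr_Cnorm/= cos2Dsin2 mul1r.
Qed.

End Complex.

(** * The Gabor sum when all products have support in one period *)
Section Gabor.
Variable R : realType.
Local Notation mu := (@lebesgue_measure R).
Implicit Types (f k : R -> R[i]) (a b s : R).

Lemma Rintegral_vanish (W : set R) (phi : R -> R) :
  (forall t, ~ W t -> phi t = 0) -> \int[mu]_t phi t = \int[mu]_(t in W) phi t.
Proof.
move=> phi0; congr fine; rewrite [RHS]integral_mkcond; apply: eq_integral => t _.
by rewrite patchE; case: ifPn => //; rewrite notin_setE => /phi0 ->.
Qed.

Lemma integral_vanish (W : set R) (phi : R -> \bar R) :
  (forall t, ~ W t -> phi t = 0%E) -> (\int[mu]_t phi t = \int[mu]_(t in W) phi t)%E.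
Proof.
move=> phi0; rewrite [RHS]integral_mkcond; apply: eq_integral => t _.
by rewrite patchE; case: ifPn => //; rewrite notin_setE => /phi0.
Qed.

(** Half the sum of the series and of its reflection m |-> -m: cross terms that
    are odd in m disappear. *)
Lemma esum_int_symmetrize (Y e : int -> R) : (forall m, 0 <= Y m) ->
  (forall m, 0 <= e m) -> (forall m, Y m + Y (- m) = 2 * e m) ->
  (\esum_(m in [set: int]) (Y m)%:E = \esum_(m in [set: int]) (e m)%:E)%E.
Proof.
move=> Y0 e0 Ye.
have EN : (\esum_(m in [set: int]) (Y m)%:E = \esum_(m in [set: int]) (Y (- m)%R)%:E)%E.
  apply: (@reindex_esum _ _ _ _ _ (fun m : int => - m)); split.
  - by [].
  - by move=> x y _ _; exact: oppr_inj.
  - by move=> y _; exists (- y) => //; rewrite opprK.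
have E2 : (\esum_(m in [set: int]) (Y m)%:E + \esum_(m in [set: int]) (Y m)%:E =
    2%:E * \esum_(m in [set: int]) (e m)%:E)%E.
  rewrite {2}EN -esumD; try by move=> m _; rewrite lee_fin.
  rewrite -esumZl//.
  by apply: eq_esum => m _; rewrite -EFinD -EFinM Ye.
have /(congr1 (fun x => 2^-1%:E * x)%E) := E2.
rewrite muleA -EFinM mulVf// mul1e => <-.
have : (0 <= \esum_(m in [set: int]) (Y m)%:E)%E by apply: esum_ge0 => m _; rewrite lee_fin.
move: (esum _ _) => S S0; case: S S0 => [x|_|//]; last by rewrite addye// gt0_muley ?lte_fin.
by rewrite -EFinD -EFinM => _; congr EFin; field.
Qed.

(** For u and v the real and imaginary parts of f times the conjugate of k, the
    squared coefficients at m and -m add up to twice the coefficient energies of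
    u and v, so the real identity applies to u and to v. *)
Lemma complex_parseval f k b s : 0 < b -> Cmeasurable f -> Cmeasurable k ->
  (\int[mu]_t (Cnorm (f t) ^+ 2 * Cnorm (k t) ^+ 2)%:E < +oo)%E ->
  (forall t, ~ window b s t -> Cnorm (f t) ^+ 2 * Cnorm (k t) ^+ 2 = 0) ->
  (\esum_(m in [set: int]) (Cnorm (inner f (modulation (m%:~R * b) k)) ^+ 2)%:E =
   b^-1%:E * \int[mu]_t (Cnorm (f t) ^+ 2 * Cnorm (k t) ^+ 2)%:E)%E.
Proof.
move=> b0 mf mk fkfin fk0; set W := window b s.
have mW : measurable (W : set (measurableTypeR R)) by exact: measurable_window.
pose u := reP f k; pose v := imP f k.
have mu_ : measurable_fun [set: R] u by exact: measurable_reP.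
have mv : measurable_fun [set: R] v by exact: measurable_imP.
have uv t : u t ^+ 2 + v t ^+ 2 = Cnorm (f t) ^+ 2 * Cnorm (k t) ^+ 2 by exact: sqr_reP_imP.
have mfk : measurable_fun [set: R] (fun t => (Cnorm (f t) ^+ 2 * Cnorm (k t) ^+ 2)%:E).
  by apply/measurable_EFinP; apply: measurable_funM; exact: measurable_sqr_Cnorm.
have ifk : mu.-integrable W (fun t => (Cnorm (f t) ^+ 2 * Cnorm (k t) ^+ 2)%:E).
  apply: (integrableS measurableT) => //; apply/integrableP; split => //.
  apply: le_lt_trans fkfin; rewrite le_eqVlt; apply/orP; left; apply/eqP.
  by apply: eq_integral => t _; rewrite gee0_abs// lee_fin mulr_ge0 ?sqr_ge0.
have sqW (p : R -> R) : measurable_fun [set: R] p ->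
    (forall t, p t ^+ 2 <= Cnorm (f t) ^+ 2 * Cnorm (k t) ^+ 2) -> sqint mu W p.
  move=> mp pfk; split=> //; apply: le_integrable ifk => //.
    by apply/measurable_EFinP/measurable_funTS; exact: measurable_funX.
  move=> t _ /=; rewrite lee_fin ger0_norm ?sqr_ge0// ger0_norm; first exact: pfk.
  by apply: mulr_ge0; exact: sqr_ge0.
have su : sqint mu W u by apply: sqW => // t; rewrite -uv lerDl sqr_ge0.
have sv : sqint mu W v by apply: sqW => // t; rewrite -uv lerDr sqr_ge0.
have u0 t : ~ W t -> u t = 0.
  move=> /fk0; rewrite -uv => /eqP; rewrite paddr_eq0 ?sqr_ge0// => /andP[+ _].
  by rewrite sqrf_eq0 => /eqP.
have v0 t : ~ W t -> v t = 0.
  move=> /fk0; rewrite -uv => /eqP; rewrite paddr_eq0 ?sqr_ge0// => /andP[_ +].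
  by rewrite sqrf_eq0 => /eqP.
pose X (p : R -> R) (m : int) (th : R) := ip mu W p (wave b m th).
have sw m th : sqint mu W (wave b m th) by exact: sqint_wave.
pose Y m := Cnorm (inner f (modulation (m%:~R * b) k)) ^+ 2.
have YE m : Y m = (X u m 0 + X v m (pi / 2)) ^+ 2 + (X v m 0 - X u m (pi / 2)) ^+ 2.
  rewrite /Y sqr_inner; congr (_ ^+ 2 + _ ^+ 2).
    rewrite (@Rintegral_vanish W); last first.
      by move=> t nW; rewrite reP_modulation -/u -/v u0// v0// !mul0r addr0.
    rewrite /X /ip -RintegralD//; [|exact: sqint_mul..].
    by apply: eq_Rintegral => t _; rewrite reP_modulation.
  rewrite (@Rintegral_vanish W); last first.
    by move=> t nW; rewrite imP_modulation -/u -/v u0// v0// !mul0r subr0.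
  rewrite /X /ip -RintegralB//; [|exact: sqint_mul..].
  by apply: eq_Rintegral => t _; rewrite imP_modulation.
have YY m : Y m + Y (- m) = 2 * (coef_energy b s u m + coef_energy b s v m).
  rewrite !YE /X !coef_opp0 !coef_opp_pihalf// /coef_energy; ring.
have Y0 m : 0 <= Y m by exact: sqr_ge0.
have EY : (\esum_(m in [set: int]) (Y m)%:E = energy b s u + energy b s v)%E.
  rewrite (esum_int_symmetrize _ _ YY) => [|//|m]; last by rewrite addr_ge0// coef_energy_ge0.
  under eq_esum do rewrite EFinD.
  by rewrite esumD// => m _; rewrite lee_fin coef_energy_ge0.
rewrite EY !parseval_identity// -EFinD -mulrDr EFinM; congr (_ * _)%E.
rewrite (@integral_vanish W); last by move=> t /fk0 ->.
have ipE p : sqint mu W p -> (ip mu W p p)%:E = (\int[mu]_(t in W) (p t ^+ 2)%:E)%E.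
  move=> [_ ip_]; rewrite /ip /Rintegral -[RHS]fineK; last exact: integrable_fin_num.
  by congr (fine _)%:E; apply: eq_integral => t _; rewrite expr2.
rewrite EFinD !ipE// -ge0_integralD//=; last 4 first.
- by move=> t _; rewrite lee_fin sqr_ge0.
- by apply/measurable_EFinP/measurable_funTS; exact: measurable_funX.
- by move=> t _; rewrite lee_fin sqr_ge0.
- by apply/measurable_EFinP/measurable_funTS; exact: measurable_funX.
by apply: eq_integral => t _; rewrite -EFinD uv.
Qed.

Definition gabor f k a b : \bar R :=
  (\esum_(mn in [set: int * int]) ((Cnorm (inner f (WHsystem k a b mn))) ^+ 2)%:E)%E.

Lemma gaborE f k a b : gabor f k a b =
  (\esum_(n in [set: int]) \esum_(m in [set: int])
    (Cnorm (inner f (modulation (m%:~R * b) (translation (n%:~R * a) k))) ^+ 2)%:E)%E.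
Proof.
rewrite esum_esum; last by move=> *; rewrite lee_fin sqr_ge0.
rewrite /gabor (reindex_esum ([set: int] `*`` (fun=> [set: int])) _ (fun x => (x.2, x.1)))//.
split=> //; first by move=> [x1 x2] [y1 y2] _ _ [-> ->].
by move=> [x y] _; exists (y, x).
Qed.

Definition density k a t : \bar R :=
  (\esum_(n in [set: int]) (Cnorm (k (t - n%:~R * a)%R) ^+ 2)%:E)%E.

Lemma density_ge0 k a t : (0 <= density k a t)%E.
Proof. by apply: esum_ge0 => n _; rewrite lee_fin sqr_ge0. Qed.

Lemma measurable_density k a : Cmeasurable k -> measurable_fun [set: R] (density k a).
Proof.
move=> mk; apply: measurable_esum_int => [n|n t]; last by rewrite lee_fin sqr_ge0.
apply/measurable_EFinP; apply: (@measurable_sqr_Cnorm _ (translation _ k)).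
exact: Cmeasurable_translation.
Qed.

(** The interval may depend on n, because Parseval's identity is used for one
    translate at a time. *)
Lemma gabor_window f k a b : 0 < b -> Cmeasurable f -> Cmeasurable k ->
  (forall n : int, (\int[mu]_t
     (Cnorm (f t) ^+ 2 * Cnorm (k (t - n%:~R * a)) ^+ 2)%:E < +oo)%E) ->
  (forall n : int, exists s, forall t, ~ window b s t ->
     Cnorm (f t) ^+ 2 * Cnorm (k (t - n%:~R * a)) ^+ 2 = 0) ->
  gabor f k a b = (b^-1%:E * \int[mu]_t ((Cnorm (f t) ^+ 2)%:E * density k a t))%E.
Proof.
move=> b0 mf mk fin van; have b1 : 0 <= b^-1 by rewrite invr_ge0 ltW.
have mT n : Cmeasurable (translation (n%:~R * a) k) by exact: Cmeasurable_translation.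
rewrite gaborE (eq_esum (b := fun n : int => b^-1%:E *
    \int[mu]_t (Cnorm (f t) ^+ 2 * Cnorm (k (t - n%:~R * a)%R) ^+ 2)%:E)%E); last first.
  by move=> n _; have [s vs] := van n; exact: complex_parseval (mT n) (fin n) vs.
rewrite esumZl//; last first.
  by move=> n; apply: integral_ge0 => t _; rewrite lee_fin mulr_ge0 ?sqr_ge0.
congr (_ * _)%E; rewrite -integral_esum_int//; last 2 first.
- move=> n; apply/measurable_EFinP; apply: measurable_funM.
    exact: measurable_sqr_Cnorm.
  exact: (measurable_sqr_Cnorm (mT n)).
- by move=> n t; rewrite lee_fin mulr_ge0 ?sqr_ge0.
apply: eq_integral => t _; rewrite /density -esumZl ?sqr_ge0//.
by move=> n; rewrite lee_fin sqr_ge0.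
Qed.

End Gabor.

(** * Countable Minkowski inequality *)
Section Minkowski.
Context {R : realType}.
Local Open Scope ereal_scope.

Lemma esum_nneseries_swap (I : choiceType) (z : I -> nat -> \bar R) :
  (forall i k, 0 <= z i k) ->
  \esum_(i in [set: I]) \sum_(k <oo) z i k = \sum_(k <oo) \esum_(i in [set: I]) z i k.
Proof.
move=> z0; rewrite nneseries_esumT; last by move=> k; exact: esum_ge0.
rewrite (eq_esum (b := fun i => \esum_(k in [set: nat]) z i k)); last first.
  by move=> i _; rewrite nneseries_esumT.
rewrite !esum_esum//.
apply: (@reindex_esum _ _ _ _ _ (fun p : nat * I => (p.2, p.1))); split.
- by [].
- by move=> [x1 x2] [y1 y2] _ _ /= [-> ->].
- by move=> [i k] _; exists (k, i).
Qed.

(** The Cauchy-Schwarz inequality with weights w, in the form obtained by adding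
    |x_k| <= s w_k / 2 + x_k^2 / (2 s w_k) for s = |X| / W; only sums of
    nonnegative terms occur, so no convergence has to be checked. *)
Lemma weighted_cauchy (X : R) (x w : nat -> R) (W : R) :
  (forall k, 0 <= w k)%R -> (forall k, w k = 0 -> x k = 0)%R ->
  \sum_(k <oo) (w k)%:E <= W%:E -> `|X|%:E <= \sum_(k <oo) `|x k|%:E ->
  (X ^+ 2)%:E <= W%:E * \sum_(k <oo) (x k ^+ 2 / w k)%:E.
Proof.
move=> w0 wx wW Xx.
have Y0 : 0 <= \sum_(k <oo) (x k ^+ 2 / w k)%:E.
  by apply: nneseries_ge0 => k _ _; rewrite lee_fin divr_ge0// sqr_ge0.
have W0 : (0 <= W)%R.
  by rewrite -lee_fin (le_trans _ wW)//; apply: nneseries_ge0 => k _ _; rewrite lee_fin.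
have [->|X0] := eqVneq X 0%R; first by rewrite expr0n/= mule_ge0.
have nX : (0 < `|X|)%R by rewrite normr_gt0.
have [W00|Wn0] := eqVneq W 0%R.
  have wk0 k : w k = 0%R.
    by apply/eqP; rewrite eq_le w0 andbT -W00; exact: nneseries_term_le wW.
  suff : `|X|%:E <= 0 by rewrite lee_fin leNgt nX.
  rewrite (le_trans Xx)// eseries0// => k _ _.
  by rewrite wx ?normr0.
have Wgt : (0 < W)%R by rewrite lt0r Wn0.
have [->|Sfin] := eqVneq (\sum_(k <oo) (x k ^+ 2 / w k)%:E) +oo.
  by rewrite gt0_muley ?lte_fin// leey.
have {}Sfin : \sum_(k <oo) (x k ^+ 2 / w k)%:E \is a fin_num.
  by rewrite ge0_fin_numE// lt_neqAle Sfin leey.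
pose y := fine (\sum_(k <oo) (x k ^+ 2 / w k)%:E).
have yE : \sum_(k <oo) (x k ^+ 2 / w k)%:E = y%:E by rewrite fineK.
rewrite yE in Y0 *; rewrite lee_fin in Y0.
pose s := (`|X| / W)%R; have s0 : (0 < s)%R by rewrite divr_gt0.
have amgm k : (`|x k| <= s / 2 * w k + (2 * s)^-1 * (x k ^+ 2 / w k))%R.
  have [wk0|wk0] := eqVneq (w k) 0%R.
    by rewrite wx// wk0 normr0 expr0n/= mul0r !mulr0 addr0.
  have wk : (0 < w k)%R by rewrite lt0r wk0 w0.
  rewrite -subr_ge0 -[(x k ^+ 2)%R]real_normK ?num_real//.
  rewrite (_ : (_ - _)%R = (`|x k| - s * w k) ^+ 2 / (2 * s * w k))%R; last first.
    by field; rewrite wk0 gt_eqF.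
  apply: divr_ge0; [exact: sqr_ge0|apply: mulr_ge0 => //; apply: mulr_ge0 => //; exact: ltW].
have : `|X|%:E <= (s / 2 * W + (2 * s)^-1 * y)%:E.
  apply: (le_trans Xx).
  apply: (@le_trans _ _ (\sum_(k <oo) (s / 2 * w k + (2 * s)^-1 * (x k ^+ 2 / w k))%:E)).
    by apply: lee_nneseries => k _; rewrite lee_fin.
  under eq_eseriesr do rewrite EFinD EFinM [X in _ + X]EFinM.
  have s2 : (0 <= s / 2)%R by rewrite divr_ge0// ltW.
  have s2' : (0 <= (2 * s)^-1)%R by rewrite invr_ge0 mulr_ge0// ltW.
  have xw k : (0 <= x k ^+ 2 / w k)%R by rewrite divr_ge0 ?sqr_ge0.
  rewrite nneseriesD; try by move=> k _; rewrite -EFinM lee_fin mulr_ge0.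
  rewrite !nneseriesZl//; try by move=> k _; rewrite lee_fin.
  by rewrite yE EFinD (EFinM (s / 2) W) (EFinM _ y) leeD2r// lee_wpmul2l// lee_fin.
rewrite -EFinM !lee_fin /s.
have -> : (`|X| / W / 2 * W + (2 * (`|X| / W))^-1 * y =
  `|X| / 2 + W * y / (2 * `|X|))%R.
  by field; rewrite Wn0 gt_eqF.
move=> H; have {H} : (`|X| / 2 <= W * y / (2 * `|X|))%R by lra.
rewrite ler_pdivlMr ?mulr_gt0// => H.
rewrite -real_normK ?num_real//; apply: le_trans H.
by rewrite le_eqVlt; apply/orP; left; apply/eqP; field.
Qed.

(** X and Y stand for the real and imaginary parts of a family indexed by I, and
    w k bounds the l^2 norm of the k-th piece up to the factor sqrt C.  Summing
    the weighted Cauchy-Schwarz inequality over I gives the bound. *)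
Lemma countable_minkowski (I : choiceType) (X Y : I -> R) (x y : I -> nat -> R)
    (w : nat -> R) (W C : R) : (0 <= C)%R -> (forall k, 0 <= w k)%R ->
  \sum_(k <oo) (w k)%:E <= W%:E ->
  (forall k, \esum_(i in [set: I]) (x i k ^+ 2 + y i k ^+ 2)%:E <= (C * w k ^+ 2)%:E) ->
  (forall i, `|X i|%:E <= \sum_(k <oo) `|x i k|%:E) ->
  (forall i, `|Y i|%:E <= \sum_(k <oo) `|y i k|%:E) ->
  \esum_(i in [set: I]) (X i ^+ 2 + Y i ^+ 2)%:E <= (C * W ^+ 2)%:E.
Proof.
move=> C0 w0 wW xyw Xx Yy.
have W0 : (0 <= W)%R.
  by rewrite -lee_fin (le_trans _ wW)//; apply: nneseries_ge0 => k _ _; rewrite lee_fin.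
have xy0 i k : w k = 0%R -> (x i k = 0 /\ y i k = 0)%R.
  move=> wk0; have : (x i k ^+ 2 + y i k ^+ 2)%:E <= 0.
    have := xyw k; rewrite wk0 expr0n/= mulr0; apply: le_trans.
    have := @esum_seq_ge _ _ (fun i => (x i k ^+ 2 + y i k ^+ 2)%:E) [:: i] isT.
    by rewrite big_seq1.
  rewrite lee_fin => h.
  have : (x i k ^+ 2 + y i k ^+ 2 == 0)%R by rewrite eq_le h addr_ge0 ?sqr_ge0.
  by rewrite paddr_eq0 ?sqr_ge0// !sqrf_eq0 => /andP[/eqP -> /eqP ->].
have pos z k : (0 <= z ^+ 2 / w k)%R by rewrite divr_ge0 ?sqr_ge0.
pose S i := \sum_(k <oo) ((x i k ^+ 2 + y i k ^+ 2) / w k)%:E.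
have S0 i : 0 <= S i.
  by apply: nneseries_ge0 => k _ _; rewrite lee_fin mulrDl addr_ge0.
have pt i : (X i ^+ 2 + Y i ^+ 2)%:E <= W%:E * S i.
  rewrite /S; under eq_eseriesr do rewrite mulrDl EFinD.
  rewrite nneseriesD; try by move=> k _; rewrite lee_fin.
  rewrite ge0_muleDr; try by apply: nneseries_ge0 => k _ _; rewrite lee_fin.
  rewrite EFinD leeD// weighted_cauchy//.
    by move=> k /xy0 => /(_ i)[].
  by move=> k /xy0 => /(_ i)[].
apply: (le_trans (le_esum (fun i _ => pt i))).
rewrite esumZl// /S esum_nneseries_swap; last first.
  by move=> i k; rewrite lee_fin mulrDl addr_ge0.
rewrite expr2 mulrCA EFinM lee_wpmul2l ?lee_fin//.
apply: (@le_trans _ _ (\sum_(k <oo) (C * w k)%:E)).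
  apply: lee_nneseries => k.
    by move=> _ _; apply: esum_ge0 => i _; rewrite lee_fin mulrDl addr_ge0.
  under eq_esum do rewrite mulrC EFinM.
  rewrite esumZl ?invr_ge0//; last by move=> i; rewrite lee_fin addr_ge0 ?sqr_ge0.
  have [->|wk0] := eqVneq (w k) 0%R; first by rewrite invr0 mul0e mulr0.
  move=> _; apply: (@le_trans _ _ ((w k)^-1%:E * (C * w k ^+ 2)%:E)).
    by rewrite lee_wpmul2l// lee_fin invr_ge0.
  by rewrite -EFinM lee_fin le_eqVlt; apply/orP; left; apply/eqP; field.
under eq_eseriesr do rewrite EFinM.
by rewrite nneseriesZl ?EFinM ?lee_wpmul2l ?lee_fin// => k _; rewrite lee_fin.
Qed.

End Minkowski.

(** * Restriction of the window function *)
Section Restriction.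
Variable R : realType.
Local Notation mu := (@lebesgue_measure R).
Implicit Types (f k : R -> R[i]) (a b s : R) (D : set R).
Local Open Scope complex_scope.

Lemma L2P f : L2 f <-> Cmeasurable f /\ (sqnorm f < +oo)%E.
Proof.
rewrite /L2 -sqr_CLnorm2; have := Lnorm_ge0 mu 2%:E (EFin \o (@Cnorm R \o f)).
rewrite -/(CLnorm 2%:E f) => N0; split=> -[mf Nf]; split=> //.
  by rewrite expe2 lte_mul_pinfty// ge0_fin_numE.
move: N0 Nf; case: (CLnorm 2%:E f) => [x _ _|_|//]; first exact: ltry.
by rewrite expe2 mulyy.
Qed.

Definition restr D k : R -> R[i] := fun t => k t * (\1_D t)%:C.

Lemma re_restr D k t : complex.Re (restr D k t) = complex.Re (k t) * \1_D t.
Proof. by rewrite /restr; case: (k t) => x y /=; rewrite mulr0 subr0. Qed.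

Lemma im_restr D k t : complex.Im (restr D k t) = complex.Im (k t) * \1_D t.
Proof. by rewrite /restr; case: (k t) => x y /=; rewrite mulr0 add0r. Qed.

Lemma Cmeasurable_restr D k : measurable D -> Cmeasurable k -> Cmeasurable (restr D k).
Proof.
move=> mD [m1 m2]; split.
  rewrite (_ : (fun _ => _) = fun t => complex.Re (k t) * \1_D t); last first.
    by apply/funext => t; rewrite re_restr.
  by apply: measurable_funM => //; exact: measurable_indic.
rewrite (_ : (fun _ => _) = fun t => complex.Im (k t) * \1_D t); last first.
  by apply/funext => t; rewrite im_restr.
by apply: measurable_funM => //; exact: measurable_indic.
Qed.

Lemma sqr_Cnorm_restr D k t : Cnorm (restr D k t) ^+ 2 = Cnorm (k t) ^+ 2 * \1_D t.
Proof.
rewrite sqr_Cnorm re_restr im_restr sqr_Cnorm indicE.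
by case: (t \in D); rewrite /= ?mulr1 ?mulr0 ?expr0n ?addr0.
Qed.

Lemma restrT k : restr setT k = k.
Proof. by apply/funext => t; rewrite /restr indicT mulr1. Qed.

Lemma Cmeasurable_modulation c f : Cmeasurable f -> Cmeasurable (modulation c f).
Proof.
move=> [m1 m2].
have mc : measurable_fun [set: R] (fun t => cos (2 * pi * c * t)).
  apply: measurableT_comp; first exact: (continuous_measurable_fun (@continuous_cos R)).
  by apply: measurable_funM.
have ms : measurable_fun [set: R] (fun t => sin (2 * pi * c * t)).
  apply: measurableT_comp; first exact: (continuous_measurable_fun (@continuous_sin R)).
  by apply: measurable_funM.
split.
  rewrite (_ : (fun _ => _) = fun t => cos (2 * pi * c * t) * complex.Re (f t) -
    sin (2 * pi * c * t) * complex.Im (f t)).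
    by apply: measurable_funB; apply: measurable_funM.
  by apply/funext => t; rewrite /modulation; case: (f t).
rewrite (_ : (fun _ => _) = fun t => cos (2 * pi * c * t) * complex.Im (f t) +
    sin (2 * pi * c * t) * complex.Re (f t)).
  by apply: measurable_funD; apply: measurable_funM.
by apply/funext => t; rewrite /modulation; case: (f t).
Qed.

Lemma sqnorm_translation c f : Cmeasurable f -> sqnorm (translation c f) = sqnorm f.
Proof.
move=> mf; apply: (@ge0_integral_shift _ c (fun t => (Cnorm (f t) ^+ 2)%:E)).
  by apply/measurable_EFinP; exact: measurable_sqr_Cnorm.
by move=> t; rewrite lee_fin sqr_ge0.
Qed.

Lemma sqnorm_modulation c f : sqnorm (modulation c f) = sqnorm f.
Proof. by apply: eq_integral => t _; rewrite sqr_Cnorm_modulation. Qed.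

Lemma L2_WHsystem k a b i : L2 k -> L2 (WHsystem k a b i).
Proof.
move=> /L2P[mk fk]; apply/L2P; split.
  exact/Cmeasurable_modulation/Cmeasurable_translation.
by rewrite /WHsystem sqnorm_modulation sqnorm_translation.
Qed.

Lemma integrable_sqr_Cnorm f : L2 f -> mu.-integrable setT (fun t => (Cnorm (f t) ^+ 2)%:E).
Proof.
move=> /L2P[mf ff]; apply/integrableP; split.
  by apply/measurable_EFinP; exact: measurable_sqr_Cnorm.
apply: le_lt_trans ff; rewrite le_eqVlt; apply/orP; left; apply/eqP.
by apply: eq_integral => t _; rewrite gee0_abs// lee_fin sqr_ge0.
Qed.

Lemma integrable_dominated (p : R -> R) f k : L2 f -> L2 k -> measurable_fun [set: R] p ->
  (forall t, `|p t| <= Cnorm (f t) ^+ 2 + Cnorm (k t) ^+ 2) ->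
  mu.-integrable setT (EFin \o p).
Proof.
move=> Lf Lk mp pfk.
have := integrableD measurableT (integrable_sqr_Cnorm Lf) (integrable_sqr_Cnorm Lk).
apply: le_integrable => //; first exact/measurable_EFinP.
move=> t _ /=; rewrite lee_fin [leRHS]ger0_norm; first exact: pfk.
by apply: addr_ge0; exact: sqr_ge0.
Qed.

Lemma integrable_reP f k : L2 f -> L2 k -> mu.-integrable setT (EFin \o reP f k).
Proof.
move=> Lf Lk; apply: (integrable_dominated Lf Lk).
  by apply: measurable_reP; [case: Lf|case: Lk].
move=> t; rewrite !sqr_Cnorm /reP ler_norml.
move: (complex.Re _) (complex.Im _) (complex.Re _) (complex.Im _) => x y z w.
have := sqr_ge0 (x + z); have := sqr_ge0 (x - z).
have := sqr_ge0 (y + w); have := sqr_ge0 (y - w).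
by move=> ? ? ? ?; apply/andP; split; nra.
Qed.

Lemma integrable_imP f k : L2 f -> L2 k -> mu.-integrable setT (EFin \o imP f k).
Proof.
move=> Lf Lk; apply: (integrable_dominated Lf Lk).
  by apply: measurable_imP; [case: Lf|case: Lk].
move=> t; rewrite !sqr_Cnorm /imP ler_norml.
move: (complex.Re _) (complex.Im _) (complex.Re _) (complex.Im _) => x y z w.
have := sqr_ge0 (x + w); have := sqr_ge0 (x - w).
have := sqr_ge0 (y + z); have := sqr_ge0 (y - z).
by move=> ? ? ? ?; apply/andP; split; nra.
Qed.

Definition shifted (c : R) D : set R := [set t | D (t - c)].

Lemma measurable_shifted c D : measurable D -> measurable (shifted c D).
Proof. by move=> mD; rewrite -[shifted c D]setTI; exact: measurable_subr. Qed.

Lemma reP_restr f k a b i D t : reP f (WHsystem (restr D k) a b i) t =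
  reP f (WHsystem k a b i) t * \1_(shifted (i.2%:~R * a) D) t.
Proof.
rewrite /WHsystem !reP_modulation /reP /imP /translation re_restr im_restr.
have -> : \1_(shifted (i.2%:~R * a) D) t = \1_D (t - i.2%:~R * a) :> R.
  by rewrite !indicE; congr (nat_of_bool _)%:R; apply/idP/idP; rewrite !inE.
ring.
Qed.

Lemma imP_restr f k a b i D t : imP f (WHsystem (restr D k) a b i) t =
  imP f (WHsystem k a b i) t * \1_(shifted (i.2%:~R * a) D) t.
Proof.
rewrite /WHsystem !imP_modulation /reP /imP /translation re_restr im_restr.
have -> : \1_(shifted (i.2%:~R * a) D) t = \1_D (t - i.2%:~R * a) :> R.
  by rewrite !indicE; congr (nat_of_bool _)%:R; apply/idP/idP; rewrite !inE.
ring.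
Qed.

Lemma Rintegral_mul_indic (p : R -> R) D :
  \int[mu]_t (p t * \1_D t) = \int[mu]_(t in D) p t.
Proof.
congr fine; rewrite [RHS]integral_mkcond; apply: eq_integral => t _.
by rewrite patchE indicE; case: (t \in D); rewrite /= ?mulr1 ?mulr0.
Qed.

Lemma abse_eseries_le (x : nat -> \bar R) : summable [set: nat] x ->
  (`|\sum_(j <oo) x j| <= \sum_(j <oo) `|x j|)%E.
Proof.
move=> sx; have sx' : summable xpredT x.
  by rewrite (_ : (fun=> _) = [set: nat])//; exact/seteqP.
rewrite summable_eseries// (le_trans (lee_abs_sub _ _))//.
rewrite !gee0_abs; try by apply: nneseries_ge0 => *.
rewrite -nneseriesD//; apply: lee_nneseries => [j _ _|j _]; first by rewrite adde_ge0.
by rewrite -[leRHS]/((abse \o x) j) fune_abse.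
Qed.

Lemma Rintegral_bigcup_le (p : R -> R) (D : (set R)^nat) :
  mu.-integrable setT (EFin \o p) -> trivIset setT D -> (forall j, measurable (D j)) ->
  (`|\int[mu]_(t in \bigcup_j D j) p t|%:E <= \sum_(j <oo) `|\int[mu]_(t in D j) p t|%:E)%E.
Proof.
move=> ip_ tD mD.
have mD' j : measurable (D j : set (measurableTypeR R)) by exact: mD.
have mU : measurable (\bigcup_j D j : set (measurableTypeR R)) by exact: bigcupT_measurable.
have iS (E : set (measurableTypeR R)) : measurable E -> mu.-integrable E (EFin \o p).
  by move=> mE; apply: (integrableS measurableT).
rewrite EFin_normr_Rintegral//; last exact: iS.
rewrite integral_bigcup//; last exact: iS.
under [leRHS]eq_eseriesr => j _ do rewrite EFin_normr_Rintegral ?iS//.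
apply: abse_eseries_le; apply: integrable_summable => //; exact: iS.
Qed.

End Restriction.

(** * Gabor sums and densities of restricted windows *)
Section Frames.
Variable R : realType.
Local Notation mu := (@lebesgue_measure R).
Implicit Types (f k : R -> R[i]) (a b s : R) (D : set R).

(** Restricting the window function to D restricts the integral that defines a
    coefficient to a translate of D; coefficients thus become countably additive
    set functions. *)
Lemma gabor_restr f k a b D : gabor f (restr D k) a b =
  (\esum_(i in [set: int * int])
    ((\int[mu]_(t in shifted (i.2%:~R * a) D) reP f (WHsystem k a b i) t) ^+ 2 +
     (\int[mu]_(t in shifted (i.2%:~R * a) D) imP f (WHsystem k a b i) t) ^+ 2)%:E)%E.
Proof.
apply: eq_esum => i _; rewrite sqr_inner; congr (_ ^+ 2 + _ ^+ 2)%:E.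
  rewrite -[RHS]Rintegral_mul_indic.
  by congr fine; apply: eq_integral => t _; rewrite reP_restr.
rewrite -[RHS]Rintegral_mul_indic.
by congr fine; apply: eq_integral => t _; rewrite imP_restr.
Qed.

Lemma gabor_bigcup_le f k a b (D : (set R)^nat) (w : nat -> R) (W C : R) :
  L2 f -> L2 k -> trivIset setT D -> (forall j, measurable (D j)) ->
  0 <= C -> (forall j, 0 <= w j) -> (\sum_(j <oo) (w j)%:E <= W%:E)%E ->
  (forall j, gabor f (restr (D j) k) a b <= (C * w j ^+ 2)%:E)%E ->
  (gabor f (restr (\bigcup_j D j) k) a b <= (C * W ^+ 2)%:E)%E.
Proof.
move=> Lf Lk tD mD C0 w0 wW Dw; rewrite gabor_restr.
have shiftU c : shifted c (\bigcup_j D j) = \bigcup_j shifted c (D j) by [].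
have tS c : trivIset setT (fun j => shifted c (D j)).
  by move=> i j _ _ [t [ti tj]]; apply: tD => //; exists (t - c).
have mS c j : measurable (shifted c (D j)) by exact: measurable_shifted.
apply: (@countable_minkowski _ _ _ _
  (fun i j => \int[mu]_(t in shifted (i.2%:~R * a) (D j)) reP f (WHsystem k a b i) t)
  (fun i j => \int[mu]_(t in shifted (i.2%:~R * a) (D j)) imP f (WHsystem k a b i) t)
  w) => //.
- by move=> j; rewrite -gabor_restr.
- move=> i; rewrite shiftU; apply: Rintegral_bigcup_le => //.
  by apply: integrable_reP => //; exact: L2_WHsystem.
- move=> i; rewrite shiftU; apply: Rintegral_bigcup_le => //.
  by apply: integrable_imP => //; exact: L2_WHsystem.
Qed.

(** Each coefficient of the restriction to D is the difference of those of k and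
    of the restriction to the complement, and |x - y|^2 <= 2|x|^2 + 2|y|^2. *)
Lemma gabor_restr_le f k a b D : L2 f -> L2 k -> measurable D ->
  (gabor f (restr D k) a b <=
   2%:E * gabor f k a b + 2%:E * gabor f (restr (~` D) k) a b)%E.
Proof.
move=> Lf Lk mD; rewrite !gabor_restr -[in X in (X + _)%E](restrT k) gabor_restr.
have sq0 (x y : R) : (0 <= (x ^+ 2 + y ^+ 2)%:E)%E by rewrite lee_fin addr_ge0 ?sqr_ge0.
rewrite -!esumZl// -esumD; try by move=> i _; rewrite mule_ge0.
apply: le_esum => i _; set c := i.2%:~R * a.
have split (p : R -> R) : mu.-integrable setT (EFin \o p) ->
    \int[mu]_(t in shifted c [set: R]) p t =
    \int[mu]_(t in shifted c D) p t + \int[mu]_(t in shifted c (~` D)) p t.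
  move=> ip_; have mS E : measurable E -> measurable (shifted c E : set (measurableTypeR R)).
    by move=> mE; exact: measurable_shifted.
  have -> : shifted c [set: R] = shifted c D `|` shifted c (~` D).
    by apply/seteqP; split=> t // _; have [|] := pselect (D (t - c)); [left|right].
  have mS1 := mS _ mD; have mS2 := mS _ (measurableC mD).
  rewrite Rintegral_setU//.
    by apply: (integrableS measurableT) => //; exact: measurableU.
  by apply/disj_set2P; apply/seteqP; split=> t // -[].
have LWH : L2 (WHsystem k a b i) by exact: L2_WHsystem.
rewrite (split (reP _ _)); last exact: integrable_reP.
rewrite (split (imP _ _)); last exact: integrable_imP.
rewrite -!EFinM -EFinD lee_fin.
move: (\int[mu]_(t in shifted c D) _) (\int[mu]_(t in shifted c D) _)
  (\int[mu]_(t in shifted c (~` D)) _) (\int[mu]_(t in shifted c (~` D)) _) => x y z w.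
have := sqr_ge0 (x + 2 * z); have := sqr_ge0 (y + 2 * w); nra.
Qed.

Lemma density_restr k a D t :
  density (restr D k) a t = (\esum_(n in [set: int])
    (Cnorm (k (t - n%:~R * a)%R) ^+ 2 * \1_D (t - n%:~R * a)%R)%:E)%E.
Proof. by apply: eq_esum => n _; rewrite sqr_Cnorm_restr. Qed.

Lemma density_split k a D t :
  density k a t = (density (restr D k) a t + density (restr (~` D) k) a t)%E.
Proof.
rewrite !density_restr -esumD; try by move=> n _; rewrite lee_fin mulr_ge0 ?sqr_ge0.
apply: eq_esum => n _; rewrite -EFinD -mulrDr !indicE in_setC.
by case: (_ \in _); rewrite /= ?addr0 ?add0r mulr1.
Qed.

Lemma density_bigcup_le k a (D : (set R)^nat) t :
  (density (restr (\bigcup_j D j) k) a t <= \sum_(j <oo) density (restr (D j) k) a t)%E.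
Proof.
rewrite density_restr.
have n0 n j : (0 <= (Cnorm (k (t - n%:~R * a)%R) ^+ 2 * \1_(D j) (t - n%:~R * a)%R)%:E)%E.
  by rewrite lee_fin mulr_ge0 ?sqr_ge0.
under eq_eseriesr do rewrite density_restr.
rewrite -esum_nneseries_swap//.
apply: le_esum => n _; set x := t - _.
have [[j _ Djx]|nD] := pselect ((\bigcup_j D j) x); last first.
  rewrite [\1_(_) x]indicE memNset// mulr0; apply: nneseries_ge0 => j _ _; exact: n0.
rewrite indicE mem_set; last by exists j.
rewrite (@nneseriesD1 _ _ j)//=; last by move=> i _; exact: n0.
rewrite -/x indicE mem_set// leeDl//; apply: nneseries_ge0 => i _ _; exact: n0.
Qed.

Lemma esum_int_window (K : nat) (w : R) (m0 : int) (P : int -> bool) : 0 <= w ->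
  (forall n, P n -> m0 <= n < m0 + K%:Z) ->
  (\esum_(n in [set: int]) (w * (P n)%:R)%:E <= (K%:R * w)%:E)%E.
Proof.
move=> w0 PK; apply: esum_seq_le => r ur.
rewrite sumEFin lee_fin -mulr_sumr mulrC ler_wpM2r// -natr_sum ler_nat.
have -> : (\sum_(n <- r) P n = size [seq n <- r | P n])%N.
  by rewrite size_filter -sum1_count [RHS]big_mkcond; apply: eq_bigr => n _; case: (P n).
rewrite -(size_map (fun n : int => `|n - m0|%N)) -[leqRHS](size_iota 0).
apply: uniq_leq_size.
  rewrite map_inj_in_uniq ?filter_uniq// => x y.
  rewrite !mem_filter => /andP[/PK xP _] /andP[/PK yP _]; lia.
move=> x /mapP[n]; rewrite mem_filter => /andP[/PK nP _] ->.
rewrite mem_iota; lia.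
Qed.

(** An interval of length l contains at most K points of a progression of step a. *)
Lemma density_piece_le k a D c l w (K : nat) : 0 < a -> l / a <= K%:R -> 0 <= w ->
  D `<=` `[c, c + l[%classic ->
  {ae mu, forall t, D t -> Cnorm (k t) <= w} ->
  {ae mu, forall t, (density (restr D k) a t <= (K%:R * w ^+ 2)%:E)%E}.
Proof.
move=> a0 lK w0 Dc kw.
have := ae_forall_int (fun n : int => ae_shift (n%:~R * a) kw).
apply: ae_mono => t kt; rewrite density_restr.
(* The least n with n a > t - c - l. *)
pose m0 := Num.floor ((t - c - l) / a) + 1.
have P n : `[< D (t - n%:~R * a) >] -> m0 <= n < m0 + K%:Z.
  move=> /asboolP/Dc; rewrite /= in_itv/= => /andP[h1 h2].
  have n1 : (t - c - l) / a < n%:~R by rewrite ltr_pdivrMr//; lra.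
  have n2 : n%:~R <= (t - c - l) / a + K%:R.
    rewrite (le_trans _ (lerD (lexx _) lK))// -mulrDl ler_pdivlMr//; lra.
  apply/andP; split; first by rewrite lezD1 floor_lt_int.
  rewrite -(ltr_int R) (le_lt_trans n2)// /m0 intrD.
  by rewrite -pmulrn ltrD2r; exact: floorD1_gt.
apply: le_trans (@esum_int_window K (w ^+ 2) m0 (fun n => `[< D (t - n%:~R * a) >]) _ P);
  last exact: sqr_ge0.
apply: le_esum => n _; rewrite lee_fin indicE.
case: (asboolP (D (t - n%:~R * a))) => [Dt|nDt]; last by rewrite memNset// !mulr0.
rewrite mem_set// !mulr1; apply: lerXn2r; rewrite ?nnegrE ?Cnorm_ge0//.
exact: kt.
Qed.

End Frames.

(** * Bounds for a window of bounded support *)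
Section Bounds.
Variable R : realType.
Local Notation mu := (@lebesgue_measure R).
Implicit Types (f k g : R -> R[i]) (a b s : R) (D : set R).

Lemma ae_le_integral (p q : R -> \bar R) :
  measurable_fun [set: R] p -> measurable_fun [set: R] q ->
  (forall t, 0 <= p t)%E -> (forall t, 0 <= q t)%E ->
  {ae mu, forall t, (p t <= q t)%E} -> (\int[mu]_t p t <= \int[mu]_t q t)%E.
Proof.
move=> mp mq p0 q0 pq; apply: ae_ge0_le_integral => //.
by apply: ae_mono pq.
Qed.

Section DensityIntegral.
Variables (f k : R -> R[i]) (a M : R).
Hypotheses (mf : Cmeasurable f) (mk : Cmeasurable k) (M0 : 0 <= M).

Let mfd : measurable_fun [set: R] (fun t => (Cnorm (f t) ^+ 2)%:E * density k a t)%E.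
Proof.
apply: emeasurable_funM; last exact: measurable_density.
by apply/measurable_EFinP; exact: measurable_sqr_Cnorm.
Qed.

Let mMf : measurable_fun [set: R] (fun t => M%:E * (Cnorm (f t) ^+ 2)%:E)%E.
Proof.
apply: emeasurable_funM => //.
by apply/measurable_EFinP; exact: measurable_sqr_Cnorm.
Qed.

Let intM : (\int[mu]_t (M%:E * (Cnorm (f t) ^+ 2)%:E) = M%:E * sqnorm f)%E.
Proof.
rewrite ge0_integralZl_EFin//.
- by move=> t _; rewrite lee_fin sqr_ge0.
- by apply/measurable_EFinP; exact: measurable_sqr_Cnorm.
Qed.

Lemma integral_density_le : {ae mu, forall t, (density k a t <= M%:E)%E} ->
  (\int[mu]_t ((Cnorm (f t) ^+ 2)%:E * density k a t) <= M%:E * sqnorm f)%E.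
Proof.
move=> dM; rewrite -intM; apply: ae_le_integral => //.
- by move=> t; rewrite mule_ge0 ?density_ge0// lee_fin sqr_ge0.
- by move=> t; rewrite mule_ge0// lee_fin sqr_ge0.
- by apply: ae_mono dM => t dt; rewrite muleC lee_wpmul2r// lee_fin sqr_ge0.
Qed.

Lemma integral_density_ge : {ae mu, forall t, (M%:E <= density k a t)%E} ->
  (M%:E * sqnorm f <= \int[mu]_t ((Cnorm (f t) ^+ 2)%:E * density k a t))%E.
Proof.
move=> dM; rewrite -intM; apply: ae_le_integral => //.
- by move=> t; rewrite mule_ge0// lee_fin sqr_ge0.
- by move=> t; rewrite mule_ge0 ?density_ge0// lee_fin sqr_ge0.
- by apply: ae_mono dM => t dt; rewrite muleC lee_wpmul2l// lee_fin sqr_ge0.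
Qed.

End DensityIntegral.

(** Here the interval for the n-th translate is the one of length 1/b centred at
    the translate of [c, c + l[. *)
Lemma gabor_supported f k a b D c l w : L2 f -> Cmeasurable k -> measurable D ->
  0 < b -> l < b^-1 -> 0 <= w -> D `<=` `[c, c + l[%classic ->
  {ae mu, forall t, D t -> Cnorm (k t) <= w} ->
  gabor f (restr D k) a b =
  (b^-1%:E * \int[mu]_t ((Cnorm (f t) ^+ 2)%:E * density (restr D k) a t))%E.
Proof.
move=> Lf mk mD b0 lb w0 Dc kw; have /L2P[mf ff] := Lf.
have mr : Cmeasurable (restr D k) by exact: Cmeasurable_restr.
apply: gabor_window => // n; last first.
  exists (c + n%:~R * a - (b^-1 - l) / 2) => t nW.
  rewrite sqr_Cnorm_restr indicE memNset ?mulr0// => /Dc.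
  rewrite /= in_itv/= => /andP[h1 h2]; apply: nW; rewrite /window/= in_itv/=.
  apply/andP; split; lra.
have fin : (\int[mu]_t ((w ^+ 2)%:E * (Cnorm (f t) ^+ 2)%:E) < +oo)%E.
  rewrite ge0_integralZl_EFin ?sqr_ge0//.
  - by rewrite lte_mul_pinfty// lee_fin sqr_ge0.
  - by move=> t _; rewrite lee_fin sqr_ge0.
  - by apply/measurable_EFinP; exact: measurable_sqr_Cnorm.
apply: le_lt_trans fin; apply: ae_le_integral.
- apply/measurable_EFinP; apply: measurable_funM; first exact: measurable_sqr_Cnorm.
  exact: (measurable_sqr_Cnorm (Cmeasurable_translation _ mr)).
- apply: emeasurable_funM => //.
  by apply/measurable_EFinP; exact: measurable_sqr_Cnorm.
- by move=> t; rewrite lee_fin mulr_ge0 ?sqr_ge0.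
- by move=> t; rewrite mule_ge0// lee_fin sqr_ge0.
have := ae_shift (n%:~R * a) kw; apply: ae_mono => t kt.
rewrite -EFinM lee_fin mulrC ler_wpM2r ?sqr_ge0// sqr_Cnorm_restr indicE.
have [Dt|nD] := pselect (D (t - n%:~R * a)); last by rewrite memNset// mulr0 sqr_ge0.
rewrite mem_set// mulr1; apply: lerXn2r; rewrite ?nnegrE ?Cnorm_ge0//; exact: kt.
Qed.

Lemma gabor_piece_le f k a b D c l w (K : nat) : L2 f -> Cmeasurable k -> measurable D ->
  0 < a -> 0 < b -> l < b^-1 -> l / a <= K%:R -> 0 <= w -> D `<=` `[c, c + l[%classic ->
  {ae mu, forall t, D t -> Cnorm (k t) <= w} ->
  (gabor f (restr D k) a b <= (b^-1 * (K%:R * w ^+ 2))%:E * sqnorm f)%E.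
Proof.
move=> Lf mk mD a0 b0 lb lK w0 Dc kw; have [mf _] := Lf.
rewrite (gabor_supported a Lf mk mD b0 lb w0 Dc kw) EFinM -muleA lee_wpmul2l//.
  by rewrite lee_fin invr_ge0 ltW.
apply: integral_density_le => //.
- exact: Cmeasurable_restr.
- by rewrite mulr_ge0// sqr_ge0.
- exact: (density_piece_le (c := c) (l := l)).
Qed.

Lemma density_bigcup_bound k a (D : (set R)^nat) (c : nat -> R) l (w : nat -> R) W (K : nat) :
  0 < a -> l / a <= K%:R -> (forall j, 0 <= w j) -> (\sum_(j <oo) (w j)%:E <= W%:E)%E ->
  (forall j, D j `<=` `[c j, c j + l[%classic) ->
  (forall j, {ae mu, forall t, D j t -> Cnorm (k t) <= w j}) ->
  {ae mu, forall t, (density (restr (\bigcup_j D j) k) a t <= (K%:R * W ^+ 2)%:E)%E}.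
Proof.
move=> a0 lK w0 wW Dc kw.
have W0 : 0 <= W.
  by rewrite -lee_fin (le_trans _ wW)//; apply: nneseries_ge0 => j _ _; rewrite lee_fin.
have wjW j : w j <= W by exact: nneseries_term_le wW.
have := ae_foralln (fun j => density_piece_le a0 lK (w0 j) (Dc j) (kw j)).
apply: ae_mono => t dt; apply: (le_trans (density_bigcup_le _ _ _ _)).
apply: (@le_trans _ _ (\sum_(j <oo) ((K%:R * W)%:E * (w j)%:E))%E).
  apply: lee_nneseries => j _; first by move=> _; exact: density_ge0.
  apply: (le_trans (dt j)); rewrite -EFinM lee_fin -mulrA ler_wpM2l// expr2 ler_wpM2r//.
rewrite nneseriesZl; last by move=> j _; rewrite lee_fin.
by rewrite expr2 mulrA [leRHS]EFinM lee_wpmul2l// lee_fin mulr_ge0.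
Qed.

End Bounds.

(** * The density of a frame *)
Section Necessary.
Variable R : realType.
Local Notation mu := (@lebesgue_measure R).
Local Open Scope complex_scope.

Definition indicC (E : set R) : R -> R[i] := fun t => (\1_E t)%:C.

Lemma sqr_Cnorm_indicC E t : Cnorm (indicC E t) ^+ 2 = \1_E t.
Proof.
rewrite sqr_Cnorm/= indicE; case: (t \in E) => /=.
  by rewrite expr1n expr0n addr0.
by rewrite !expr0n addr0.
Qed.

Lemma Cmeasurable_indicC E : measurable E -> Cmeasurable (indicC E).
Proof. by move=> mE; split => /=; [exact: measurable_indic|exact: measurable_cst]. Qed.

Lemma sqnorm_indicC E : measurable E -> sqnorm (indicC E) = mu E.
Proof.
move=> mE; rewrite /sqnorm; under eq_integral do rewrite sqr_Cnorm_indicC.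
by rewrite integral_indic// setIT.
Qed.

Lemma gabor_indicC g a b s E : 0 < b -> L2 g -> measurable E -> E `<=` window b s ->
  gabor (indicC E) g a b = (b^-1%:E * \int[mu]_(t in E) density g a t)%E.
Proof.
move=> b0 /L2P[mg fg] mE Es.
rewrite gabor_window//.
- congr (_ * _)%E; rewrite [RHS]integral_mkcond; apply: eq_integral => t _.
  by rewrite sqr_Cnorm_indicC patchE indicE; case: (t \in E); rewrite ?mul1e ?mul0e.
- exact: Cmeasurable_indicC.
- move=> n; apply: le_lt_trans fg; rewrite -(sqnorm_translation (n%:~R * a) mg).
  apply: ge0_le_integral => //.
  + by move=> t _; rewrite lee_fin mulr_ge0 ?sqr_ge0.
  + apply/measurable_EFinP; apply: measurable_funM.
      by apply: measurable_sqr_Cnorm; exact: Cmeasurable_indicC.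
    exact: (measurable_sqr_Cnorm (Cmeasurable_translation _ mg)).
  + by apply/measurable_EFinP; exact: (measurable_sqr_Cnorm (Cmeasurable_translation _ mg)).
  + move=> t _; rewrite lee_fin sqr_Cnorm_indicC indicE.
    by case: (t \in E); rewrite /= ?mul1r ?mul0r ?sqr_ge0.
- move=> n; exists s => t nW; rewrite sqr_Cnorm_indicC indicE memNset ?mul0r//.
  by move=> /Es.
Qed.

(** For f the indicator of the set E in question, the lower frame bound and the
    identity for the Gabor sum give A mu(E) <= b^-1 c mu(E) with c < bA. *)
Lemma frame_density_null g a b A B s c : WHframe_with_bounds g a b A B -> 0 <= c < b * A ->
  {ae mu, forall t, window b s t -> ~ (density g a t <= c%:E)%E}.
Proof.
move=> [Lg a0 b0 [A0 B0 _ fr]] /andP[c0 cA].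
have [mg _] := Lg.
pose E := window b s `&` [set t | (density g a t <= c%:E)%E].
have mE : measurable E.
  apply: measurableI; first exact: measurable_window.
  rewrite -[X in measurable X]setTI; apply: emeasurable_fun_le => //.
  exact: measurable_density.
have mE' : measurable (E : set (measurableTypeR R)) by exact: mE.
have Efin : (mu E < +oo)%E.
  apply: le_lt_trans (window_finite s b0); apply: le_measure; rewrite ?inE//.
    exact: measurable_window.
  by move=> t [].
have LE : L2 (indicC E).
  by apply/L2P; split; [exact: Cmeasurable_indicC|rewrite sqnorm_indicC].
have [+ _] := fr _ LE.
rewrite sqr_CLnorm2 sqnorm_indicC// -/(gabor (indicC E) g a b).
rewrite (gabor_indicC a b0 Lg mE (s := s)); last first.
  by move=> t [].
have dE : (\int[mu]_(t in E) density g a t <= c%:E * mu E)%E.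
  rewrite -integral_cst//; apply: ge0_le_integral => //.
  - by move=> t _; exact: density_ge0.
  - by apply: measurable_funTS; exact: measurable_density.
  - by move=> t [].
move=> H; have {H dE} : (A%:E * mu E <= b^-1%:E * (c%:E * mu E))%E.
  by apply: (le_trans H); rewrite lee_wpmul2l// lee_fin invr_ge0 ltW.
have [x muE] : exists x, mu E = x%:E.
  by exists (fine (mu E)); rewrite fineK// ge0_fin_numE.
rewrite muE -!EFinM lee_fin => H.
have E0 : mu E = 0%E.
  have : (0 <= mu E)%E by [].
  rewrite muE lee_fin le_eqVlt => /predU1P[<-//|x0].
  exfalso; move: H; rewrite ler_pdivlMl// mulrA ler_pM2r// => H.
  by move: cA; rewrite ltNge H.
exists E; split=> //; move=> t /=; rewrite not_implyP => -[Wt].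
by move=> /contrapT ?; split.
Qed.

Lemma window_cover (b t : R) : 0 < b -> exists i : int, window b (i%:~R / (2 * b)) t.
Proof.
move=> b0; exists (Num.ceil (2 * b * t) - 1).
have b2 : 0 < 2 * b by rewrite mulr_gt0.
have bn0 : b != 0 by rewrite gt_eqF.
rewrite /window/= in_itv/= rmorphB/=; set x := (Num.ceil _)%:~R.
have h1 : 2 * b * t <= x by exact: ceil_ge.
have h2 : x - 1 < 2 * b * t by have := ceilB1_lt (2 * b * t); rewrite rmorphB.
apply/andP; split; first by rewrite ltr_pdivrMr// mulrC.
rewrite (_ : b^-1 = 2 / (2 * b)); last by field.
by rewrite -mulrDl ltr_pdivlMr//; lra.
Qed.

(** Countably many windows and thresholds exhaust the set where the density is
    less than b A. *)
Lemma frame_density_ge g a b A B : WHframe_with_bounds g a b A B ->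
  {ae mu, forall t, ((b * A)%:E <= density g a t)%E}.
Proof.
move=> fr; have [_ _ b0 [A0 _ _ _]] := fr.
have bA0 : 0 < b * A by rewrite mulr_gt0.
(* Thresholds increasing to b A; the maximum keeps them nonnegative. *)
pose c (j : nat) := Num.max 0 (b * A - j.+1%:R^-1).
have cj j : 0 <= c j < b * A.
  by rewrite le_max lexx/= gt_max bA0/= gtrDl oppr_lt0 invr_gt0.
have := ae_foralln (fun j => ae_forall_int (fun i : int =>
  frame_density_null (i%:~R / (2 * b)) fr (cj j))).
apply: ae_mono => t H; rewrite leNgt; apply/negP => dlt.
have dfin : density g a t = (fine (density g a t))%:E.
  rewrite fineK// ge0_fin_numE ?density_ge0//.
  by apply: (lt_trans dlt); rewrite ltry.
rewrite dfin lte_fin in dlt; set d := fine _ in dfin dlt.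
have [j dj] : exists j : nat, j.+1%:R^-1 < b * A - d.
  have dA : 0 < b * A - d by rewrite subr_gt0.
  by have [j] := ltr_add_invr dA; rewrite add0r => ?; exists j.
have [i Wi] := window_cover t b0.
apply: (H j i Wi); rewrite dfin lee_fin /c le_max; apply/orP; right.
by apply: ltW; rewrite ltrBrDr addrC -ltrBrDr.
Qed.

(** Termwise, |x|^2 <= (1 + d)|y|^2 + (1 + 1/d)|x - y|^2. *)
Lemma density_perturbation (g : R -> R[i]) (a a' t c r d : R) : 0 < d ->
  (c%:E <= density g a t)%E ->
  (\esum_(n in [set: int])
     ((Cnorm (g (t - n%:~R * a)%R - g (t - n%:~R * a')%R)) ^+ 2)%:E <= r%:E)%E ->
  (((c - (1 + d^-1) * r) / (1 + d))%:E <= density g a' t)%E.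
Proof.
move=> d0 cg gr; have d1 : 0 < 1 + d by rewrite addr_gt0.
have di : 0 <= 1 + d^-1 by rewrite addr_ge0// invr_ge0 ltW.
have : (c%:E <= (1 + d)%:E * density g a' t + ((1 + d^-1) * r)%:E)%E.
  apply: (le_trans cg); rewrite EFinM.
  apply: (@le_trans _ _ ((1 + d)%:E * density g a' t + (1 + d^-1)%:E *
    \esum_(n in [set: int]) ((Cnorm (g (t - n%:~R * a)%R - g (t - n%:~R * a')%R)) ^+ 2)%:E)%E);
    last first.
    by rewrite leeD2l// lee_wpmul2l// lee_fin.
  rewrite -!esumZl ?(ltW d1)//; try by move=> n; rewrite lee_fin sqr_ge0.
  rewrite -esumD; try by move=> n _; rewrite mule_ge0// lee_fin ?sqr_ge0// ltW.
  apply: le_esum => n _; rewrite -!EFinM -EFinD lee_fin !sqr_Cnorm !raddfB/=.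
  move: (g _) (g _) => [x y] [z w] /=.
  have key (p q : R) : p ^+ 2 <= (1 + d) * q ^+ 2 + (1 + d^-1) * (p - q) ^+ 2.
    rewrite -subr_ge0 (_ : _ - _ = (d * q - (p - q)) ^+ 2 / d); last by field; rewrite gt_eqF.
    by rewrite divr_ge0 ?sqr_ge0// ltW.
  rewrite [X in _ <= X + _]mulrDr [X in _ <= _ + X]mulrDr addrACA; exact: lerD.
have := density_ge0 g a' t; case: (density g a' t) => [x|_ _|//]; last by rewrite leey.
rewrite -EFinM -EFinD !lee_fin => _ H.
rewrite ler_pdivrMr//; lra.
Qed.

End Necessary.

(** * The cells of the amalgam norm *)
Section Cells.
Variables (R : realType) (w0 : R).
Hypothesis w00 : 0 < w0.

(** The interval where the (int_of_nat j)-th term of the amalgam norm looks at g: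
    translating by n w0 and cutting to [0, w0[ reads g on -n w0 + [0, w0[. *)
Definition cell (j : nat) : set R :=
  `[- ((int_of_nat j)%:~R * w0), - ((int_of_nat j)%:~R * w0) + w0[%classic.

Lemma measurable_cell j : measurable (cell j).
Proof. exact: measurable_itv. Qed.

Lemma cell_disjoint : trivIset setT cell.
Proof.
move=> i j _ _ [t [/= ]]; rewrite /cell/= !in_itv/= => /andP[h1 h2] /andP[h3 h4].
have [_ inj _] := int_of_nat_bij; apply: inj; rewrite ?inE//.
have lt1 (x y : int) : x%:~R * w0 < y%:~R * w0 + w0 -> x < y + 1.
  move=> h; rewrite -(ltr_int R) intrD -(ltr_pM2r w00) mulrDl mul1r//.
have ij : (int_of_nat i)%:~R * w0 < (int_of_nat j)%:~R * w0 + w0 by lra.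
have ji : (int_of_nat j)%:~R * w0 < (int_of_nat i)%:~R * w0 + w0 by lra.
apply/eqP; rewrite eq_le -!ltzD1; apply/andP; split; exact: lt1.
Qed.

Lemma cell_cover t : exists j, cell j t.
Proof.
have [j jt] := int_of_nat_surj (- Num.floor (t / w0)); exists j.
rewrite /cell/= jt in_itv/= rmorphN/= mulNr opprK.
have h1 := floor_le (t / w0); have h2 := floorD1_gt (t / w0).
rewrite intrD in h2.
rewrite ler_pdivlMr// in h1; rewrite ltr_pdivrMr// mulrDl mul1r in h2.
by rewrite h1.
Qed.

Lemma cell_bounded N j : (j < N)%N ->
  cell j `<=` `[- (N.+1%:R * w0), - (N.+1%:R * w0) + 2 * N.+1%:R * w0[%classic.
Proof.
move=> jN t; rewrite /cell/= !in_itv/= => /andP[h1 h2].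
have [n1 n2] : - N%:Z <= int_of_nat j /\ int_of_nat j <= N%:Z.
  by rewrite /int_of_nat; have := half_leq (ltnW jN); have := uphalf_half N; case: ifP; lia.
have m1 : - (N%:R * w0) <= (int_of_nat j)%:~R * w0.
  by rewrite -mulNr ler_pM2r// pmulrn -rmorphN ler_int.
have m2 : (int_of_nat j)%:~R * w0 <= N%:R * w0.
  by rewrite ler_pM2r// pmulrn ler_int.
rewrite -natr1; apply/andP; split; nra.
Qed.

End Cells.

(** * The window function on the cells *)
Section Amalgam.
Variable R : realType.
Local Notation mu := (@lebesgue_measure R).
Variables (g : R -> R[i]) (w0 : R).
Hypothesis gfin : (Wnorm w0 g < +oo)%E.

Definition cell_norm (j : nat) : R :=
  fine (CLnorm +oo%E (Defs.cut w0 (translation ((int_of_nat j)%:~R * w0) g))).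

Let N_ge0 j : (0 <= CLnorm +oo%E (Defs.cut w0 (translation ((int_of_nat j)%:~R * w0)%R g)))%E.
Proof. exact: Lnorm_ge0. Qed.

Lemma Wnorm_nneseries : (Wnorm w0 g =
  \sum_(j <oo) CLnorm +oo%E (Defs.cut w0 (translation ((int_of_nat j)%:~R * w0)%R g)))%E.
Proof. by rewrite /Wnorm esum_int// => n; exact: Lnorm_ge0. Qed.

Lemma cell_normE j :
  CLnorm +oo%E (Defs.cut w0 (translation ((int_of_nat j)%:~R * w0) g)) = (cell_norm j)%:E.
Proof.
rewrite /cell_norm fineK// ge0_fin_numE//; apply: le_lt_trans gfin.
rewrite Wnorm_nneseries (@nneseriesD1 _ _ j)// leeDl//.
exact: nneseries_ge0.
Qed.

Lemma cell_norm_ge0 j : 0 <= cell_norm j.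
Proof. by rewrite -lee_fin -cell_normE. Qed.

Lemma sum_cell_norm : (\sum_(j <oo) (cell_norm j)%:E < +oo)%E.
Proof.
by rewrite (eq_eseriesr (fun j _ => esym (cell_normE j))) -Wnorm_nneseries.
Qed.

Lemma lebesgue_setT_gt0 : (0 < mu [set: R])%E.
Proof.
apply: (@lt_le_trans _ _ (mu `[0, 1]%classic)).
  by rewrite lebesgue_measure_itv/= lte_fin ltr01 -EFinB subr0 lte_fin.
by apply: le_measure; rewrite ?inE.
Qed.

Lemma ae_cell_bound j : {ae mu, forall t, cell w0 j t -> Cnorm (g t) <= cell_norm j}.
Proof.
set c := (int_of_nat j)%:~R * w0.
have H : {ae mu, forall t, (Cnorm (Defs.cut w0 (translation c g) t) <= cell_norm j)%R}.
  have := cell_normE j; rewrite /CLnorm unlock lebesgue_setT_gt0 => E.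
  have := ess_sup_ge mu (abse \o (EFin \o (@Cnorm R \o Defs.cut w0 (translation c g)))).
  rewrite E; apply: ae_mono => t /=; rewrite lee_fin; apply: le_trans; exact: ler_norm.
have := ae_shift (- c) H; apply: ae_mono => t; rewrite opprK => tc ct.
apply: le_trans tc; rewrite /Defs.cut /translation addrK indicE mem_set ?mulr1//.
move: ct; rewrite /cell/= -/c !in_itv/= => /andP[h1 h2]; apply/andP; split; lra.
Qed.

End Amalgam.

(** * Stability of the frame under a change of the translation step *)
Theorem theorem3p5 (R : realType) (g : R -> complex R) (a b A B r : R)
    (ha : 0 < a) (hb : 0 < b) (hg : Wiener g)
    (hframe : WHframe_with_bounds g a b A B)
    (hr0 : 0 < r) (hr : r < b * A) :
  exists eps : R, (0 < eps /\ eps <= a / 2) /\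
  exists b0 : R, 0 < b0 /\
  forall a' : R, `|a - a'| < eps ->
    {ae (@lebesgue_measure R), forall t : R,
      (\esum_(n in [set: int])
         ((Cnorm (g (t - n%:~R * a)%R - g (t - n%:~R * a')%R)) ^+ 2)%:E
       <= r%:E)%E} ->
    forall b' : R, 0 < b' -> b' < b0 -> WHframe g a' b'.
Proof.
have [Lg [w0 w00 gfin]] := hg; have [mg _] := Lg.
pose mu := @lebesgue_measure R.
have bAr : 0 < b * A - r by rewrite subr_gt0.
(* This choice makes (1 + 1/d) r the midpoint of r and b A. *)
pose d := 2 * r / (b * A - r).
have d0 : 0 < d by rewrite divr_gt0// mulr_gt0.
pose c := (b * A - (1 + d^-1) * r) / (1 + d).
have c0 : 0 < c.
  apply: divr_gt0; last by rewrite addr_gt0.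
  have -> : (1 + d^-1) * r = (r + b * A) / 2 by rewrite /d; field; rewrite !gt_eqF.
  lra.
have [K hK] : exists K : nat, w0 / (a / 2) <= K.+1%:R.
  by exists (Num.truncn (w0 / (a / 2))); rewrite ltW// truncnS_gt.
pose w := cell_norm g w0.
have w_ge0 j : 0 <= w j by exact: cell_norm_ge0.
have wfin := sum_cell_norm gfin; rewrite -/w in wfin.
pose W := fine (\sum_(j <oo) (w j)%:E)%E + 1.
have sw0 : (0 <= \sum_(j <oo) (w j)%:E)%E.
  by apply: nneseries_ge0 => j _ _; rewrite lee_fin.
have W0 : 0 < W by rewrite ltr_wpDl// fine_ge0.
have wW : (\sum_(j <oo) (w j)%:E <= W%:E)%E.
  by rewrite /W EFinD fineK ?ge0_fin_numE// leeDl.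
have wjW j : w j <= W by exact: nneseries_term_le wW.
(* tau <= 1 and tau <= c / (6 K.+1) make 3 K.+1 tau^2 at most c / 2. *)
pose tau := Num.min 1 (c / (6 * K.+1%:R)).
have tau0 : 0 < tau by rewrite lt_min ltr01/= divr_gt0// mulr_gt0.
have tauc : 3 * (K.+1%:R * tau ^+ 2) <= c / 2.
  have t1 : tau <= 1 by rewrite ge_min lexx.
  have t2 : tau * (6 * K.+1%:R) <= c.
    by rewrite -ler_pdivlMr ?mulr_gt0// ge_min lexx orbT.
  have : tau ^+ 2 <= tau by rewrite expr2 ler_piMl// ltW.
  have : 0 < K.+1%:R :> R by [].
  nra.
(* The first N cells will carry the main part of g. *)
have [N hN] : exists N : nat, (\sum_(j <oo) (w (j + N)%N)%:E <= tau%:E)%E.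
  have := nneseries_tail_cvg wfin (fun j _ => w_ge0 j).
  move=> /fine_cvgP[[N1 _ H1] /cvgrPdist_le /(_ tau tau0)[N2 _ H2]].
  exists (maxn N1 N2).
  have := H1 _ (leq_maxl N1 N2); have := H2 _ (leq_maxr N1 N2).
  rewrite /= sub0r normrN => H3 H4.
  rewrite (nneseries_addn (f := fun j => (w j)%:E)); last by move=> j; rewrite lee_fin.
  by rewrite -(fineK H4) lee_fin (le_trans (ler_norm _)).
(* The first N cells lie in an interval of length l, centred at 0. *)
pose l := 2 * N.+1%:R * w0.
have l0 : 0 < l by rewrite !mulr_gt0.
have w0l : w0 <= l.
  by rewrite /l -natr1; have : 0 <= N%:R :> R by []; nra.
exists (a / 2); split; first by rewrite divr_gt0.
exists l^-1; split; first by rewrite invr_gt0.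
move=> a' aa' hae b' b'0 b'l.
have a'a : a / 2 < a' by move: aa'; rewrite ltr_norml => /andP[]; lra.
have a'0 : 0 < a' by rewrite (lt_trans _ a'a)// divr_gt0.
have lK : w0 / a' <= K.+1%:R.
  apply: le_trans hK; rewrite ler_pM2l// lef_pV2 ?posrE ?divr_gt0//; exact: ltW.
have lb : l < b'^-1 by rewrite -[l]invrK ltf_pV2 ?posrE ?invr_gt0.
have w0b : w0 < b'^-1 by rewrite (le_lt_trans w0l).
pose D := cell w0.
have mD j : measurable (D j) by exact: measurable_cell.
have Dt j :
  D j `<=` `[- ((int_of_nat j)%:~R * w0), - ((int_of_nat j)%:~R * w0) + w0[%classic by [].
have Dw j := ae_cell_bound gfin j; rewrite -/mu -/w in Dw.
pose D1 := \bigcup_(j in `I_N) D j.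
pose D2 j := D (j + N)%N.
have mD1 : measurable D1 by apply: bigcup_measurable.
have tD : trivIset setT D by exact: cell_disjoint.
have tD2 : trivIset setT D2.
  by move=> i j _ _ /(tD (i + N)%N (j + N)%N I I)/addIn.
have D1C : ~` D1 = \bigcup_j D2 j.
  apply/seteqP; split=> t.
    move=> nD1; have [j Dj] := cell_cover w00 t.
    have [jN|Nj] := ltnP j N; first by exfalso; apply: nD1; exists j.
    by exists (j - N)%N => //; rewrite /D2 subnK.
  move=> [j _ D2t] [i /= iN Dit].
  have ij := tD i (j + N)%N I I (ex_intro _ t (conj Dit D2t)).
  by move: iN; rewrite ij ltnNge leq_addl.
have DT : \bigcup_j D j = setT.
  by apply/seteqP; split=> t // _; have [j Dj] := cell_cover w00 t; exists j.
have D1l : D1 `<=` `[- (N.+1%:R * w0), - (N.+1%:R * w0) + l[%classic.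
  by move=> t [j /= jN]; exact: (cell_bounded w00 jN).
have D1W : {ae mu, forall t, D1 t -> Cnorm (g t) <= W}.
  have := ae_foralln Dw; apply: ae_mono => t H [j _ Djt].
  exact: (le_trans (H j Djt)).
have dens : {ae mu, forall t, (c%:E <= density g a' t)%E}.
  have := frame_density_ge hframe; move: hae; apply: ae_mono2 => t H1 H2.
  exact: density_perturbation d0 H2 H1.
have dens2 : {ae mu, forall t, (density (restr (~` D1) g) a' t <= (K.+1%:R * tau ^+ 2)%:E)%E}.
  rewrite D1C; apply: (density_bigcup_bound (l := w0) (w := fun j => w (j + N)%N)
    (c := fun j => - ((int_of_nat (j + N))%:~R * w0))) => //.
  - by move=> j; exact: Dt.
  - by move=> j; exact: Dw.
have dens1 : {ae mu, forall t, ((c - K.+1%:R * tau ^+ 2)%:E <= density (restr D1 g) a' t)%E}.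
  move: dens dens2; apply: ae_mono2 => t H1 H2.
  rewrite EFinB leeBlDr//; apply: (le_trans H1); rewrite (density_split g a' D1 t).
  by rewrite leeD2l.
exists (c / (4 * b')), (b'^-1 * K.+1%:R * W ^+ 2); split=> //; split.
- by rewrite divr_gt0// mulr_gt0.
- by rewrite !mulr_gt0 ?invr_gt0// exprn_gt0.
- by move=> i; exact: L2_WHsystem.
move=> f Lf; have /L2P[mf ffin] := Lf.
rewrite sqr_CLnorm2 -/(gabor f g a' b').
have [F FE] : exists F, sqnorm f = F%:E.
  by exists (fine (sqnorm f)); rewrite fineK// ge0_fin_numE ?sqnorm_ge0.
have F0 : 0 <= F by rewrite -lee_fin -FE sqnorm_ge0.
have bi0 : 0 <= b'^-1 by rewrite invr_ge0 ltW.
have C0 : 0 <= b'^-1 * K.+1%:R * F by rewrite !mulr_ge0.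
have piece j : (gabor f (restr (D j) g) a' b' <= (b'^-1 * K.+1%:R * F * w j ^+ 2)%:E)%E.
  have := gabor_piece_le Lf mg (mD j) a'0 b'0 w0b lK (w_ge0 j) (@Dt j) (Dw j).
  by rewrite FE -EFinM; congr (_ <= _%:E)%E; ring.
rewrite FE; split; last first.
  rewrite -[X in gabor _ X](restrT g) -DT -EFinM.
  have := gabor_bigcup_le Lf Lg tD mD C0 w_ge0 wW piece.
  by congr (_ <= _%:E)%E; ring.
have S2 : (gabor f (restr (~` D1) g) a' b' <= (b'^-1 * K.+1%:R * F * tau ^+ 2)%:E)%E.
  rewrite D1C; apply: (gabor_bigcup_le (w := fun j => w (j + N)%N)) => //.
  - by move=> j; exact: mD.
  - by move=> j; exact: piece.
have S1 : ((b'^-1 * ((c - K.+1%:R * tau ^+ 2) * F))%:E <= gabor f (restr D1 g) a' b')%E.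
  rewrite (gabor_supported a' Lf mg mD1 b'0 lb (ltW W0) D1l D1W) EFinM lee_wpmul2l//.
  rewrite EFinM -FE; apply: integral_density_ge => //; first exact: Cmeasurable_restr.
  lra.
have := gabor_restr_le a' b' Lf Lg mD1.
have : (0 <= gabor f g a' b')%E by apply: esum_ge0 => i _; rewrite lee_fin sqr_ge0.
case: (gabor f g a' b') => [S S0|_ _|//]; last by exact: leey.
move=> H; have {H S1 S2} : ((b'^-1 * ((c - K.+1%:R * tau ^+ 2) * F))%:E <=
    2%:E * S%:E + 2%:E * (b'^-1 * K.+1%:R * F * tau ^+ 2)%:E)%E.
  apply: (le_trans S1); apply: (le_trans H); rewrite leeD2l// lee_wpmul2l//.
rewrite -!EFinM -EFinD !lee_fin => H.
have -> : c / (4 * b') * F = 4^-1 * (b'^-1 * F) * c by field; rewrite gt_eqF.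
have bF : 0 <= b'^-1 * F by rewrite mulr_ge0.
have : (b'^-1 * F) * (c - 3 * (K.+1%:R * tau ^+ 2)) <= 2 * S.
  move: H; rewrite -subr_ge0 => H; rewrite -subr_ge0.
  by apply: le_trans H _; rewrite le_eqVlt; apply/orP; left; apply/eqP; ring.
have : (b'^-1 * F) * (3 * (K.+1%:R * tau ^+ 2)) <= (b'^-1 * F) * (c / 2).
  exact: ler_wpM2l.
lra.
Qed.
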